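(* For every $A\ge1$ there is a constant $C=C(A)>0$, depending only on $A$, such that the following holds. Let $n\ge1$, $\delta\in(0,1/3)$ and $\gamma>0$. Suppose that: (a) $(X,Y),(X_1,Y_1),\dots,(X_n,Y_n)$ are independent and identically distributed; (b) conditionally on $X$, the noise $\varepsilon=Y-g(X)$ is sub-Gaussian with parameter $\sigma^2>0$: $\mathbb E[\varepsilon\mid X]=0$ and $\mathbb E[\exp(s\varepsilon)\mid X]\le\exp(s^2\sigma^2/2)$ for all $s\in\mathbb R$; (c) $g$ is $L$-Lipschitz on $S_X$ with respect to $\|\cdot\|_2$; (d) there is a function $\ell:S_X\to(0,\infty)$ such that, almost surely, $P^X(\mathcal V(x))\ge\ell(x)\lambda(\mathcal V(x))$ for all $x\in S_X$; (e) the local map $\mathcal V$ is VC with dimension $v$ and is $(\delta,n)$-large; (f) the local map $\mathcal V$ is $\gamma$-shape-regular, i.e. $\mathrm{diam}(\mathcal V(x))^d\le\gamma\,\lambda(\mathcal V(x))$ for all $x\in S_X$; (g) for all $x\in S_X$, $A^{-1}r\le\lambda(\mathcal V(x))\le A\,r$, where $r=\left(\log((n+1)^v/\delta)/n\right)^{d/(d+2)}$. Then, with probability at least $1-3\delta$, for all $x\in S_X$, $$|\hat g_{\mathcal V}(x)-g(x)|\le C\,c(x)\left(\frac1n\log\left(\frac{(n+1)^v}{\delta}\right)\right)^{1/(d+2)},\qquad c(x)=\sqrt{\sigma^2/\ell(x)}+L(\mathcal V(x))\,\gamma^{1/d}.$$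
   Context: $(X,Y)$ is a random vector with $X\in S_X\subset\mathbb R^d$ ($d\ge1$) and $Y\in\mathbb R$; $g(x)=\mathbb E[Y\mid X=x]$; $P^X$ is the law of $X$; $nP_n^X(A)=\sum_{i=1}^n\mathbf 1_A(X_i)$; $\lambda$ is Lebesgue measure on $\mathbb R^d$. A local map is a mapping $\mathcal V:S_X\to\mathcal B(S_X)$ (Borel subsets of $S_X$) with $x\in\mathcal V(x)$ for all $x$; it may be random and depend on the full sample and on additional randomness. Conditions imposed on $\mathcal V$ are understood to hold almost surely, simultaneously for all $x\in S_X$. The associated estimator is $\hat g_{\mathcal V}(x)=\sum_{i=1}^nY_i\mathbf 1_{\mathcal V(x)}(X_i)/\sum_{i=1}^n\mathbf 1_{\mathcal V(x)}(X_i)$, with $0/0=0$. For a collection $\mathcal A$ of subsets of $\mathbb R^d$, $\mathbb S_{\mathcal A}(n)$ is the supremum over $n$ distinct points $z_1,\dots,z_n\in\mathbb R^d$ of the cardinality of $\{(\mathbf 1_A(z_1),\dots,\mathbf 1_A(z_n)):A\in\mathcal A\}$, and $vc(\mathcal A)=\max\{n\ge1:\mathbb S_{\mathcal A}(n)=2^n\}$. $\mathcal V$ is VC with dimension $v$ if $\{\mathcal V(x):x\in S_X\}\subset\mathcal A$ for a fixed (deterministic) collection $\mathcal A$ with $vc(\mathcal A)=v$. A VC local map with dimension $v>0$ is $(\delta,n)$-large if, almost surely, for all $x\in S_X$, $$n\max\{P_n^X(\mathcal V(x)),P^X(\mathcal V(x))\}\ge36\log\left(\frac{4(2n+1)^v}{\delta}\right).$$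 For $V\subset S_X$, $L(V)$ is the smallest constant $c$ such that $|g(x)-g(y)|\le c\|x-y\|_2$ for all $x,y\in V$, and $\mathrm{diam}(V)=\sup_{x,y\in V}\|x-y\|_2$.
   Formalization: The fixed VC collection containing all V(x) is also assumed measurable: for each m, the set of m-point samples on which it realizes a given trace is universally measurable. Without this, chains of null sets removed from balls give counterexamples. *)

(* Defs.v *)
From HB Require Import structures.
From mathcomp Require Import all_boot all_order all_algebra.
From mathcomp Require Import all_classical all_reals all_analysis.
From mathcomp Require Import measurable_realfun.

Set Implicit Arguments.
Unset Strict Implicit.
Unset Printing Implicit Defensive.

Import Order.TTheory GRing.Theory Num.Theory.
Import numFieldNormedType.Exports.

Local Open Scope classical_set_scope.
Local Open Scope ring_scope.

(* Points of R^d are d-tuples: their canonical sigma-algebra, generated by the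
   coordinates, is the Borel one. *)

Section euclidean_space.
Context {R : realType}.

Definition edist {d : nat} (x y : d.-tuple R) : R :=
  Num.sqrt (\sum_(i < d) (tnth x i - tnth y i) ^+ 2).

Definition diam {d : nat} (V : set (d.-tuple R)) : \bar R :=
  ereal_sup [set r | exists x y, [/\ V x, V y & r = (edist x y)%:E]].

(* Lebesgue measure on R^d as an iterated product measure:
   lambda_0 is the unit mass at the empty tuple, and lambda_(d+1)(A) is the
   integral over x of lambda_d of the section of A at first coordinate x.
   Meaningful on Borel sets only. *)
Fixpoint lebesgue {d : nat} : set (d.-tuple R) -> \bar R :=
  match d return set (d.-tuple R) -> \bar R with
  | 0 => fun A => \d_([tuple]) A
  | d'.+1 => fun A =>
      (\int[lebesgue_measure]_x lebesgue [set t : d'.-tuple R | A [tuple of (x : R) :: t]])%E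
  end.

Lemma lebesgue_box (d : nat) (a b : d.-tuple R) :
    (forall i, tnth a i <= tnth b i) ->
  lebesgue [set t | forall i, tnth a i <= tnth t i <= tnth b i] =
  (\prod_(i < d) (tnth b i - tnth a i))%:E.
Proof.
elim: d a b => [|d IH] a b ab /=.
  rewrite big_ord0 diracE mem_set//; by case.
rewrite big_ord_recl EFinM.
set p := (\prod_(i < d) _)%R.
have H x : lebesgue [set t : d.-tuple R | forall i,
      tnth a i <= tnth [tuple of x :: t] i <= tnth b i] =
    ((p * \1_(`[tnth a ord0, tnth b ord0]) x)%:E)%E.
  rewrite indicE; have [xab|xab] := boolP (_ \in _).
    rewrite mulr1.
    pose a' := [tuple tnth a (lift ord0 i) | i < d].
    pose b' := [tuple tnth b (lift ord0 i) | i < d].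
    have -> : p = \prod_(i < d) (tnth b' i - tnth a' i).
      by apply: eq_bigr => i _; rewrite !tnth_mktuple.
    rewrite -IH; last by move=> i; rewrite !tnth_mktuple.
    congr lebesgue; apply/seteqP; split => t /= h i.
      by rewrite !tnth_mktuple; have := h (lift ord0 i); rewrite tnthS.
    case: (unliftP ord0 i) => [j ->|->].
      by rewrite tnthS; have := h j; rewrite !tnth_mktuple.
    by rewrite tnth0; move: xab; rewrite inE /= in_itv.
  rewrite mulr0; rewrite (_ : [set _ | _] = set0).
    by elim: (d) => [|k IHk] /=; [rewrite dirac0|rewrite integral0_eq].
  rewrite -subset0 => t /= /(_ ord0); rewrite tnth0 => h.
  by move/negP: xab; apply; rewrite inE /= in_itv.
under eq_integral do rewrite H EFinM.
have p0 : 0 <= p.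
  by apply: prodr_ge0 => i _; rewrite subr_ge0 ab.
rewrite ge0_integralZl//=; last exact/measurable_EFinP/measurable_indic.
rewrite integral_indic//= setIT lebesgue_measure_itv/= muleC.
case: ifP => [_|]; first by rewrite -EFinB.
rewrite lte_fin => /negbT; rewrite -leNgt => ba.
have -> : tnth b ord0 = tnth a ord0 by apply/le_anti; rewrite ba ab.
by rewrite subrr.
Qed.

Definition euclidean_lipschitz {d : nat} (V : set (d.-tuple R)) (g : d.-tuple R -> R)
    (c : R) : Prop :=
  forall x y, V x -> V y -> `|g x - g y| <= c * edist x y.

(* Constants are taken nonnegative, so that the smallest one also exists when
   V has at most one point. *)
Definition lip_const {d : nat} (g : d.-tuple R -> R) (V : set (d.-tuple R)) : R :=
  inf [set c | 0 <= c /\ euclidean_lipschitz V g c].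

End euclidean_space.

Section vapnik_chervonenkis.
Context {R : realType} {d : nat}.
Implicit Type AA : set (set (d.-tuple R)).

Definition has_trace AA (m : nat) (z : m.-tuple (d.-tuple R)) (I : {set 'I_m}) :=
  exists2 A, AA A & forall i, A (tnth z i) <-> i \in I.

Definition nb_traces AA (m : nat) (z : m.-tuple (d.-tuple R)) : nat :=
  #|[set I : {set 'I_m} | `[< has_trace AA z I >]]|.

(* The supremum is a maximum, as nb_traces AA z <= 2 ^ m. *)
Definition shatter_coef AA (m : nat) : nat :=
  \max_(k < (2 ^ m).+1 | `[< exists z : m.-tuple (d.-tuple R),
                             uniq z /\ nb_traces AA z = k >]) k.

Definition vc_dim_eq AA (v : nat) : Prop :=
  [/\ (0 < v)%N, shatter_coef AA v = (2 ^ v)%N &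
      forall m, (0 < m)%N -> shatter_coef AA m = (2 ^ m)%N -> (m <= v)%N].

(* Measurability of a class in the sense of empirical process theory: the set
   of m-samples on which the class realizes a given trace is universally
   measurable. It holds for pointwise measurable classes and for image
   admissible Suslin classes. *)
Definition trace_measurable AA : Prop :=
  forall (m : nat) (I : {set 'I_m})
    (mu : probability (m.-tuple (d.-tuple R)) R),
  exists B1 B2 : set (m.-tuple (d.-tuple R)),
    [/\ measurable B1, measurable B2,
        B1 `<=` [set z | has_trace AA z I],
        [set z | has_trace AA z I] `<=` B2 & mu (B2 `\` B1) = 0%E].

End vapnik_chervonenkis.

Section random_variables.
Context {disp : measure_display} {Omega : measurableType disp} {R : realType}.
Variable P : probability Omega R.

Definition mutually_independent {disp' : measure_display}
    {T : measurableType disp'} {I : finType} (Z : I -> Omega -> T) : Prop :=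
  forall B : I -> set T, (forall i, measurable (B i)) ->
  P [set w | forall i, B i (Z i w)] = (\prod_i P (Z i @^-1` B i))%E.

Definition identically_distributed {disp' : measure_display}
    {T : measurableType disp'} {I : finType} (Z : I -> Omega -> T) : Prop :=
  forall i j B, measurable B -> P (Z i @^-1` B) = P (Z j @^-1` B).

(* h is a version of x |-> E[Z | X = x]. *)
Definition is_cond_exp {disp' : measure_display} {T : measurableType disp'}
    (X : {RV P >-> T}) (Z : Omega -> R) (h : T -> R) : Prop :=
  [/\ P.-integrable setT (EFin \o Z),
      measurable_fun setT h,
      P.-integrable setT (EFin \o (h \o X)) &
      forall B, measurable B ->
        (\int[P]_(w in X @^-1` B) (Z w)%:E =
         \int[P]_(w in X @^-1` B) (h (X w))%:E)%E].

Definition cond_sub_gaussian {disp' : measure_display}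
    {T : measurableType disp'} (X : {RV P >-> T}) (eps : Omega -> R)
    (sigma : R) : Prop :=
  is_cond_exp X eps (fun=> 0) /\
  forall s : R, exists2 h : T -> R,
    is_cond_exp X (fun w => expR (s * eps w)) h &
    {ae P, forall w, h (X w) <= expR (s ^+ 2 * sigma ^+ 2 / 2)}.

End random_variables.

Section local_maps.
Context {disp : measure_display} {Omega : measurableType disp} {R : realType}.
Context {d : nat}.
Variable P : probability Omega R.
Variable S : set (d.-tuple R).

(* A random local map is given by its realizations V w, w : Omega; there is no
   restriction on the way in which V w depends on w. *)
Variable V : Omega -> d.-tuple R -> set (d.-tuple R).

Definition local_map : Prop :=
  {ae P, forall w, forall x, S x ->
    [/\ measurable (V w x), V w x `<=` S & V w x x]}.

Definition vc_local_map (AA : set (set (d.-tuple R))) (v : nat) : Prop :=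
  vc_dim_eq AA v /\ {ae P, forall w, forall x, S x -> AA (V w x)}.

Definition shape_regular (gamma : R) : Prop :=
  {ae P, forall w, forall x, S x ->
    ((diam (V w x)) ^+ d <= gamma%:E * lebesgue (V w x))%E}.

Context {n : nat}.
Variable Xs : 'I_n -> {RV P >-> d.-tuple R}.

Definition emp_measure (w : Omega) (A : set (d.-tuple R)) : R :=
  n%:R^-1 * \sum_(i < n) \1_A (Xs i w).

Definition large_map (X : {RV P >-> d.-tuple R}) (v : nat) (delta : R) : Prop :=
  {ae P, forall w, forall x, S x ->
    ((36 * ln (4 * (2 * n).+1%:R ^+ v / delta))%:E <=
     n%:R%:E * maxe (emp_measure w (V w x))%:E (distribution P X (V w x)))%E}.

(* 0 / 0 = 0, as 0^-1 = 0. *)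
Definition local_estimator (Ys : 'I_n -> {RV P >-> R}) (w : Omega)
    (x : d.-tuple R) : R :=
  (\sum_(i < n) Ys i w * \1_(V w x) (Xs i w)) /
  (\sum_(i < n) \1_(V w x) (Xs i w)).

End local_maps.

(* The pair (X, Y) followed by the sample, indexed by None and by Some i. *)
Definition generic_and_sample {T U V : Type} {n : nat} (X : T -> U) (Y : T -> V)
    (Xs : 'I_n -> T -> U) (Ys : 'I_n -> T -> V) (o : option 'I_n) (w : T) : U * V :=
  if o is Some i then (Xs i w, Ys i w) else (X w, Y w).

(* Main.v *)
(* On the event where, for every B in the class, (1) nP(B) >= 36 Lambda forces B to contain
   at least nP(B)/9 sample points and (2) the noise satisfies
   (sum_i eps_i 1_B(X_i))^2 <= 2 sigma^2 Lambda' #{i : X_i in B},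
   the error at x splits into a bias, at most the local Lipschitz constant times the diameter
   of V(x), and a noise term of order sigma sqrt(lg / #{i : X_i in V(x)}); shape regularity and
   the size condition on V(x) turn both into the announced rate.
   (1) is Vapnik and Chervonenkis' ghost sample argument, phrased with the probabilities q(I)
   that the class has trace I on the double sample: q is invariant under swaps, the q(I) sum
   up to at most (2n+1)^v by Sauer's lemma, and a Chernoff bound over random swaps controls the
   sum of the q(I) over the unbalanced I.
   (2) is a Chernoff bound for each trace I, summed over I: on the event that I is a trace of
   the class on (X_1, ..., X_n), the product of the exp(s eps_i), i in I, can be integrated
   conditionally on X_1, ..., X_n, and the probabilities of these events sum up to at most
   (n+1)^v. *)
Require Import Defs.
From HB Require Import structures.
From mathcomp Require Import all_boot all_order all_algebra.
From mathcomp Require Import all_classical all_reals all_analysis.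
From mathcomp Require Import measurable_realfun ring lra.

Set Implicit Arguments.
Unset Strict Implicit.
Unset Printing Implicit Defensive.

Import Order.TTheory GRing.Theory Num.Theory.
Import numFieldNormedType.Exports.

Local Open Scope set_scope.
Local Open Scope ring_scope.

(** * Traces of a class on a sample *)

Definition shatters {T : finType} (F : {set {set T}}) (J : {set T}) : bool :=
  [forall K : {set T}, (K \subset J) ==> [exists I in F, I :&: J == K]].

Lemma shattersP {T : finType} (F : {set {set T}}) (J : {set T}) :
  reflect (forall K : {set T}, K \subset J -> exists2 I, I \in F & I :&: J = K)
          (shatters F J).
Proof.
apply: (iffP forallP) => [h K KJ|h K].
  by have /implyP/(_ KJ)/exists_inP[I IF /eqP] := h K; exists I.
by apply/implyP => /h[I IF e]; apply/exists_inP; exists I => //; exact/eqP.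
Qed.

(* Splitting F according to membership of a point x, a set shattered by both
   parts stays shattered by F after adding x. *)
Lemma pajor {T : finType} (F : {set {set T}}) :
  (#|F| <= #|[set J | shatters F J]|)%N.
Proof.
have [k] := ubnP #|F|; elim: k F => // k IH F /ltnSE Fk.
have [F1|] := leqP #|F| 1.
  have [->|/set0Pn[I IF]] := eqVneq F finset.set0; first by rewrite cards0.
  apply: leq_trans F1 _; apply/card_gt0P; exists finset.set0.
  rewrite inE; apply/shattersP => K; rewrite finset.subset0 => /eqP ->.
  by exists I => //; rewrite finset.setI0.
move=> /card_gt1P[I1 [I2 [I1F I2F I12]]].
(* Two different members of [F] are separated by some [x]; hence both parts of [F] are nonempty, and
   both are small enough for the induction. *)
have {I1 I2 I1F I2F I12} [x [I1 [I2 [I1F I2F xI1 xI2]]]] :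
    exists x I1 I2, [/\ I1 \in F, I2 \in F, x \in I1 & x \notin I2].
  have : ~~ ((I1 \subset I2) && (I2 \subset I1)) by rewrite -finset.eqEsubset.
  by rewrite negb_and => /orP[] /subsetPn[x ? ?];
    [exists x, I1, I2|exists x, I2, I1].
pose F1 := [set I in F | x \in I]; pose F0 := [set I in F | x \notin I].
have F01 : (#|F| = #|F1| + #|F0|)%N.
  rewrite -(cardsID [set I : {set T} | x \in I] F); congr (_ + _)%N;
    by apply: eq_card => I; rewrite !inE // andbC.
have cF1 : (0 < #|F1|)%N by apply/card_gt0P; exists I1; rewrite inE I1F.
have cF0 : (0 < #|F0|)%N by apply/card_gt0P; exists I2; rewrite inE I2F.
have l1 : (#|F1| < k)%N by apply: leq_trans Fk; rewrite F01 -{1}[#|F1|]addn0 ltn_add2l.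
have l0 : (#|F0| < k)%N by apply: leq_trans Fk; rewrite F01 -{1}[#|F0|]add0n ltn_add2r.
have := leq_add (IH _ l1) (IH _ l0); rewrite -F01 => /leq_trans; apply.
set S1 := [set J | shatters F1 J]; set S0 := [set J | shatters F0 J].
have x1 J : J \in S1 -> x \notin J.
  rewrite inE => /shattersP h; apply/negP => xJ.
  have [I] := h finset.set0 (finset.sub0set _); rewrite !inE => /andP[_ xI] /setP/(_ x).
  by rewrite !inE xI xJ.
have x0 J : J \in S0 -> x \notin J.
  rewrite inE => /shattersP h; apply/negP => xJ.
  have [I] := h J (subxx _); rewrite !inE => /andP[_ /negbTE xI] /setP/(_ x).
  by rewrite !inE xI xJ.
have inj : {in S1 :&: S0 &, injective (fun J => x |: J)}.
  move=> J J' /finset.setIP[/x1 xJ _] /finset.setIP[/x1 xJ' _] /setP h; apply/setP => y.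
  have := h y; rewrite !inE; have [->|//] := eqVneq y x.
  by rewrite (negbTE xJ) (negbTE xJ').
(* A set shattered by both parts is counted twice: once as [J] and once as [x |: J], which lies
   outside [S1 :|: S0] because no set there contains [x]. *)
rewrite -finset.cardsUI -(card_in_imset inj).
have dis : [disjoint S1 :|: S0 & [set x |: J | J in S1 :&: S0]].
  rewrite -finset.setI_eq0; apply/eqP/setP => J; rewrite !inE; apply/negbTE/negP.
  move=> /andP[hJ /imsetP[J' _ JE]]; have : x \in J by rewrite JE finset.setU11.
  by apply/negP; case/orP: hJ => hJ; [apply: x1|apply: x0]; rewrite inE.
have := finset.leq_card_setU (S1 :|: S0) [set x |: J | J in S1 :&: S0].
move=> -[_]; rewrite dis => /eqP <-; apply: subset_leq_card.
have sub01 (G : {set {set T}}) J : G \subset F -> shatters G J -> shatters F J.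
  move=> GF /shattersP h; apply/shattersP => K /h[I IG <-]; exists I => //.
  exact: (fintype.subsetP GF).
have F1F : F1 \subset F by apply/fintype.subsetP => I; rewrite inE => /andP[].
have F0F : F0 \subset F by apply/fintype.subsetP => I; rewrite inE => /andP[].
rewrite !finset.subUset; apply/andP; split; first apply/andP; first split.
- by apply/fintype.subsetP => J; rewrite !inE; exact: sub01.
- by apply/fintype.subsetP => J; rewrite !inE; exact: sub01.
apply/fintype.subsetP => _ /imsetP[J /finset.setIP[J1 J0] ->]; rewrite inE.
have xJ := x1 _ J1; apply/shattersP => K KJ.
(* [K] is realized by a member of [F1] or of [F0], according to whether [x] is in [K], whose trace
   on [J] is [K :\ x]. *)
have KJ' : K :\ x \subset J.
  apply/fintype.subsetP => y; rewrite !inE => /andP[yx].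
  by move/(fintype.subsetP KJ); rewrite !inE (negbTE yx).
move: J1 J0; rewrite !inE => /shattersP/(_ _ KJ')[I1' + e1] /shattersP/(_ _ KJ')[I0' + e0].
rewrite !inE => /andP[I1F' xI1'] /andP[I0F' /negbTE xI0'].
have [xK|/negbTE xK] := boolP (x \in K).
  exists I1' => //; apply/setP => y; rewrite !inE.
  have [->|yx] := eqVneq y x; first by rewrite xI1' xK.
  by have /setP/(_ y) := e1; rewrite !inE yx.
exists I0' => //; apply/setP => y; rewrite !inE.
have [->|yx] := eqVneq y x; first by rewrite xI0' xK.
by have /setP/(_ y) := e0; rewrite !inE yx.
Qed.

(** The elements of such a set, listed in order and padded with [None], form a map from ['I_v] to
    [option 'I_m] that determines the set, and there are [m.+1 ^ v] such maps. *)
Lemma card_small_sets (m v : nat) :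
  (#|[set J : {set 'I_m} | (#|J| <= v)%N]| <= m.+1 ^ v)%N.
Proof.
pose im (f : {ffun 'I_v -> option 'I_m}) := [set i | Some i \in codom f].
have -> : (m.+1 ^ v = #|{ffun 'I_v -> option 'I_m}|)%N.
  by rewrite card_ffun card_option !card_ord.
apply: leq_trans (leq_imset_card im _); apply/subset_leq_card/fintype.subsetP => J.
rewrite inE => Jv; apply/imsetP.
exists [ffun k : 'I_v => nth None (map some (enum J)) k] => //.
apply/setP => i; rewrite inE; apply/idP/codomP => [iJ|[k]].
  have ij : (index i (enum J) < size (enum J))%N by rewrite index_mem mem_enum.
  have iv : (index i (enum J) < v)%N by apply: leq_trans Jv; rewrite cardE.
  exists (Ordinal iv); rewrite ffunE/= (nth_map i)// nth_index ?mem_enum//.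
rewrite ffunE; have [kJ|Jk] := ltnP k (size (enum J)).
  by rewrite (nth_map i)// => -[->]; rewrite -mem_enum mem_nth.
by rewrite nth_default// size_map.
Qed.

Section sauer.
Context {R : realType} {d : nat}.
Implicit Types (AA : set (set (d.-tuple R))).

Lemma shatter_coef_full AA (m : nat) (z : m.-tuple (d.-tuple R)) :
  uniq z -> (forall I, has_trace AA z I) -> shatter_coef AA m = (2 ^ m)%N.
Proof.
move=> uz h; apply/eqP; rewrite eqn_leq; apply/andP; split.
  by apply/bigmax_leqP => k _; rewrite -ltnS.
have <- : nb_traces AA z = (2 ^ m)%N.
  rewrite /nb_traces -[m in RHS]card_ord -cardsT -card_powerset.
  apply: eq_card => I; rewrite powersetT finset.in_setT.
  by apply/mem_set/asboolP.
have lt : (nb_traces AA z < (2 ^ m).+1)%N.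
  rewrite ltnS -[m in (2 ^ m)%N]card_ord -cardsT -card_powerset.
  by apply/subset_leq_card/fintype.subsetP => I _; rewrite inE finset.subsetT.
rewrite /shatter_coef (bigD1 (Ordinal lt)) ?leq_maxl//=.
by apply/asboolP; exists z.
Qed.

(* z may have repeated entries: those indexed by a shattered set are distinct. *)
Lemma nb_traces_le AA (v m : nat) (z : m.-tuple (d.-tuple R)) :
  vc_dim_eq AA v -> (nb_traces AA z <= m.+1 ^ v)%N.
Proof.
move=> [v0 _ vmax]; 
pose F : {set {set 'I_m}} := [set I | `[< has_trace AA z I >]].
have -> : nb_traces AA z = #|F|.
  by apply: eq_card => I; rewrite inE; apply/idP/idP => [/set_mem//|/mem_set].
apply: leq_trans (pajor F) (leq_trans _ (card_small_sets m v)).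
apply/subset_leq_card/fintype.subsetP => J; rewrite !inE => /shattersP h.
have [->//|J0] := posnP #|J|.
apply: vmax => //.
pose z' : #|J|.-tuple (d.-tuple R) := [tuple tnth z (enum_val i) | i < #|J|].
apply: (@shatter_coef_full _ _ z').
  apply/tuple_uniqP => i j; rewrite !tnth_mktuple => zij.
  apply: enum_val_inj.
  have iJ : [set enum_val i] \subset J by rewrite finset.sub1set enum_valP.
  have [I] := h _ iJ.
  rewrite inE => /asboolP[B _ BI] /setP IJ.
  have : enum_val i \in I.
    by have := IJ (enum_val i); rewrite !inE eqxx => /andP[].
  move=> /BI; rewrite zij => /BI jI; apply/esym/eqP.
  by have := IJ (enum_val j); rewrite !inE jI enum_valP.
move=> I; pose K := [set enum_val i | i in I].
have KJ : K \subset J by apply/fintype.subsetP => _ /imsetP[i _ ->]; exact: enum_valP.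
have [I' + I'K] := h K KJ; rewrite inE => /asboolP[B AB BI].
exists B => // i; rewrite tnth_mktuple BI.
have /setP/(_ (enum_val i)) := I'K; rewrite inE enum_valP andbT => ->.
by rewrite mem_imset//; exact: enum_val_inj.
Qed.

End sauer.

(** * Random swaps of a double sample *)

Section swaps.
Context {R : realType} {n : nat}.

(** The indices [lshift n i] belong to the sample and [rshift n i] to the ghost sample; [s] decides
    separately for each [i] whether these two are exchanged. *)
Definition swap (s : {ffun 'I_n -> bool}) (k : 'I_(n + n)) : 'I_(n + n) :=
  match fintype.split k with
  | inl i => if s i then rshift n i else lshift n i
  | inr i => if s i then lshift n i else rshift n i
  end.

Lemma swapl s i : swap s (lshift n i) = if s i then rshift n i else lshift n i.
Proof. by rewrite /swap (unsplitK (inl i)). Qed.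

Lemma swapr s i : swap s (rshift n i) = if s i then lshift n i else rshift n i.
Proof. by rewrite /swap (unsplitK (inr i)). Qed.

Lemma swapK s : involutive (swap s).
Proof.
move=> k; case: (splitP k) => i ki.
  have -> : k = lshift n i by exact: val_inj.
  by rewrite swapl; case: ifP => h; rewrite ?swapl ?swapr h.
have -> : k = rshift n i by exact: val_inj.
by rewrite swapr; case: ifP => h; rewrite ?swapl ?swapr h.
Qed.

Definition swap_set s (I : {set 'I_(n + n)}) := [set k | swap s k \in I].

Lemma swap_setK s : involutive (swap_set s).
Proof. by move=> I; apply/setP => k; rewrite !inE swapK. Qed.

(** The level [12 * Lam] is a third of the threshold [36 * Lam]: a ghost sample will be required to
    hit a set at least a third as often as expected. *)
Definition unbalanced (Lam : R) (I : {set 'I_(n + n)}) : bool :=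
  ((3 * \sum_(i < n) (lshift n i \in I) <= \sum_(i < n) (rshift n i \in I))%N) &&
  (12 * Lam <= (\sum_(i < n) (rshift n i \in I))%N%:R).

(* A weight of mean 1 under a random swap; its product over i is at least
   exp Lam on unbalanced sets, which bounds their frequency. *)
Let u (a b : bool) : R := if a == b then 1 else if b then 4 / 3 else 2 / 3.

Let u_ge0 a b : 0 <= u a b.
Proof. by rewrite /u; case: a b => [] []; rewrite //= divr_ge0. Qed.

(** The exponent is chosen for its sum over [i]: on an unbalanced set the terms [(b - 3 a) / 6] add
    up to a nonnegative number and the terms [b / 12] to at least [Lam]. The two mixed cases come
    from [1 + x <= expR x] at [1 / 2] and [- 1 / 4]. *)
Let u_ge (a b : bool) : expR ((b%:R - 3 * a%:R) / 6 + b%:R / 12) <= u a b.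
Proof.
case: a b => [] []; rewrite /u/=.
- by rewrite -[leRHS]expR0 ler_expR; lra.
- have := expR_ge1Dx (1 / 2 : R).
  have -> : (0 - 3 * 1) / 6 + 0 / 12 = - (1 / 2) :> R by lra.
  have -> : 2 / 3 = (3 / 2)^-1 :> R by field.
  by rewrite expRN lef_pV2 ?posrE ?expR_gt0//; lra.
- have := expR_ge1Dx (- (1 / 4) : R).
  have -> : (1 - 3 * 0) / 6 + 1 / 12 = 1 / 4 :> R by lra.
  have -> : 4 / 3 = (3 / 4)^-1 :> R by field.
  by rewrite expRN -[X in _ -> X <= _]invrK lef_pV2 ?posrE ?invr_gt0 ?expR_gt0//; lra.
- by rewrite -[leRHS]expR0 ler_expR; lra.
Qed.

(** Markov's inequality for [U] under uniformly random swaps. The sum of products over [s] factors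
    into a product over [i], with factors [u a b + u b a = 2]. *)
Lemma sum_unbalanced (Lam : R) (J : {set 'I_(n + n)}) :
  \sum_(s : {ffun 'I_n -> bool}) (unbalanced Lam (swap_set s J))%:R <=
  2 ^+ n * expR (- Lam).
Proof.
pose U (I : {set 'I_(n + n)}) := \prod_(i < n) u (lshift n i \in I) (rshift n i \in I).
have U_ge I : (unbalanced Lam I)%:R <= U I * expR (- Lam).
  have [/andP[h1 h2]|_] := boolP (unbalanced Lam I); last first.
    by rewrite mulr_ge0 ?expR_ge0//; apply: prodr_ge0 => i _; exact: u_ge0.
  rewrite expRN -ler_pdivrMr ?invr_gt0 ?expR_gt0// invrK mul1r.
  have : \prod_(i < n) expR (((rshift n i \in I)%:R - 3 * (lshift n i \in I)%:R) / 6
      + (rshift n i \in I)%:R / 12) <= U I.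
    by apply: ler_prod => i _; rewrite expR_ge0 u_ge.
  apply: le_trans; rewrite -expR_sum ler_expR big_split/= -!mulr_suml sumrB.
  rewrite -mulr_sumr -!natr_sum; move: h1; rewrite -(ler_nat R) natrM; lra.
apply: le_trans (_ : \sum_(s : {ffun 'I_n -> bool}) U (swap_set s J) * expR (- Lam) <= _).
  by apply: ler_sum => s _; exact: U_ge.
rewrite -mulr_suml ler_wpM2r ?expR_ge0//.
rewrite (eq_bigr (fun s : {ffun 'I_n -> bool} => \prod_(i < n)
  (if s i then u (rshift n i \in J) (lshift n i \in J)
   else u (lshift n i \in J) (rshift n i \in J)))); last first.
  by move=> s _; apply: eq_bigr => i _; rewrite !inE swapl swapr; case: ifP.
rewrite -(bigA_distr_bigA (fun i (b : bool) =>
  if b then u (rshift n i \in J) (lshift n i \in J)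
   else u (lshift n i \in J) (rshift n i \in J))).
rewrite -[n in 2 ^+ n]card_ord -prodr_const; apply: ler_prod => i _.
rewrite sumr_ge0/=; last by move=> b _; case: ifP => _; exact: u_ge0.
rewrite big_bool/=.
by rewrite /u; case: (_ \in J) (_ \in J) => [] []/=; lra.
Qed.

Definition swap_tuple {T : Type} s (z : (n + n).-tuple T) : (n + n).-tuple T :=
  [tuple tnth z (swap s k) | k < n + n].

Lemma has_trace_swap {d : nat} (AA : set (set (d.-tuple R)))
    (z : (n + n).-tuple (d.-tuple R)) s (I : {set 'I_(n + n)}) :
  has_trace AA (swap_tuple s z) I ->
  has_trace AA z (swap_set s I).
Proof.
move=> [B AB BI]; exists B => // k; rewrite inE -BI.
by rewrite tnth_mktuple swapK.
Qed.

End swaps.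

Local Close Scope set_scope.
Local Open Scope classical_set_scope.
Local Open Scope ring_scope.

(** * Independence and laws of samples *)

Section tuple_measure.
Context {disp : measure_display} {T : measurableType disp} {R : realType}.

Definition rect {I : finType} {U : Type} (Z : I -> U -> T) (B : I -> set T) :=
  [set u | forall i, B i (Z i u)].

Lemma measurable_rect {I : finType} {disp' : measure_display}
    {U : measurableType disp'} (Z : I -> U -> T) (B : I -> set T) :
  (forall i, measurable_fun setT (Z i)) -> (forall i, measurable (B i)) ->
  measurable (rect Z B).
Proof.
move=> mZ mB; rewrite (_ : rect Z B = \bigcap_(i in setT) (Z i @^-1` B i)).
  apply: fin_bigcap_measurable => [|i _]; first exact: finite_finset.
  by rewrite -[X in measurable X]setTI; exact: mZ.
by apply/seteqP; split => u h i; [move=> _|]; exact: h.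
Qed.

(** Rectangles are stable under intersection and generate the sigma-algebra of tuples: a coordinate
    preimage is a rectangle whose other sides are the whole space. *)
Lemma tuple_measure_unique (m : nat)
    (m1 m2 : {measure set (m.-tuple T) -> \bar R}) :
  (forall B : 'I_m -> set T, (forall i, measurable (B i)) ->
     m1 (rect (fun i z => tnth z i) B) = m2 (rect (fun i z => tnth z i) B)) ->
  (m1 setT < +oo)%E -> forall F, measurable F -> m1 F = m2 F.
Proof.
move=> m12 m1oo.
pose G := [set F | exists2 B : 'I_m -> set T, forall i, measurable (B i) &
                     F = rect (fun i z => tnth z i) B].
have GT : G setT by exists (fun=> setT) => //; apply/seteqP; split.
apply: (measure_unique G (fun=> setT)) => //.
- apply/seteqP; split; last first.
    apply: smallest_sub; first exact: sigma_algebra_measurable.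
    move=> _ [B mB ->]; apply: measurable_rect => // i; exact: measurable_tnth.
  apply: smallest_sub; first exact: smallest_sigma_algebra.
  rewrite -bigcup_seq => F [i _ [B mB <-]]; apply: sub_sigma_algebra.
  exists (fun j => if j == i then B else setT); first by move=> j; case: ifP.
  rewrite setTI; apply/seteqP; split => z h; first by move=> j; case: eqP => [->|].
  by have := h i; rewrite eqxx.
- move=> _ _ [B mB ->] [B' mB' ->]; exists (fun i => B i `&` B' i).
    by move=> i; exact: measurableI.
  apply/seteqP; split => z; first by move=> [h h'] i; split.
  by move=> h; split => i; have [] := h i.
- by apply/seteqP; split => // z _; exists 0%N.
- by move=> _ [B mB ->]; exact: m12.
Qed.

Lemma measurable_mktuple {m : nat} {disp' : measure_display}
    {U : measurableType disp'} (Z : 'I_m -> U -> T) :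
  (forall i, measurable_fun setT (Z i)) ->
  measurable_fun setT (fun u => [tuple Z i u | i < m]).
Proof.
move=> mZ; apply/measurable_fun_tnthP => i.
by apply: eq_measurable_fun (mZ i) => u _ /=; rewrite tnth_mktuple.
Qed.

End tuple_measure.

(** * Image of a measure with a density *)

Section weighted_law.
Context {disp disp' : measure_display} {U : measurableType disp}
  {T : measurableType disp'} {R : realType}.
Variables (mu : {measure set U -> \bar R}) (Z : U -> T) (G : U -> R).

(** The image under [Z] of the measure with density [G] with respect to [mu]. Carrying the proofs
    [mZ], [mG] and [G0] as parameters lets the measure structure be attached to this function. *)
Definition weighted_law (mZ : measurable_fun setT Z) (mG : measurable_fun setT G)
    (G0 : forall u, 0 <= G u) (B : set T) : \bar R :=
  (\int[mu]_(u in Z @^-1` B) (G u)%:E)%E.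

Hypotheses (mZ : measurable_fun setT Z) (mG : measurable_fun setT G).
Hypothesis (G0 : forall u, 0 <= G u).

Let mpre B : measurable B -> measurable (Z @^-1` B).
Proof. by move=> mB; rewrite -[X in measurable X]setTI; exact: mZ. Qed.

Let wlaw0 : weighted_law mZ mG G0 set0 = 0%E.
Proof. by rewrite /weighted_law preimage_set0 integral_set0. Qed.

Let wlaw_ge0 B : (0 <= weighted_law mZ mG G0 B)%E.
Proof. by apply: integral_ge0 => u _; rewrite lee_fin. Qed.

Let wlaw_sigma : semi_sigma_additive (weighted_law mZ mG G0).
Proof.
move=> F mF tF mUF; rewrite /weighted_law preimage_bigcup ge0_integral_bigcup//.
- apply: is_cvg_ereal_nneg_natsum_cond => n _ _.
  by apply: integral_ge0 => u _; rewrite lee_fin.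
- by move=> i; exact: mpre.
- exact/measurable_funTS/measurable_EFinP.
- by move=> u _; rewrite lee_fin.
- apply/trivIsetP => i j _ _ ij; rewrite -preimage_setI.
  by move/trivIsetP : tF => ->//; rewrite preimage_set0.
Qed.

HB.instance Definition _ :=
  isMeasure.Build _ _ _ (weighted_law mZ mG G0) wlaw0 wlaw_ge0 wlaw_sigma.

Lemma weighted_lawE B : measurable B ->
  weighted_law mZ mG G0 B = (\int[mu]_u (G u * \1_B (Z u))%:E)%E.
Proof.
move=> mB; rewrite /weighted_law integral_mkcond; apply: eq_integral => u _.
rewrite /patch /= indicE; have [uB|uB] := boolP (Z u \in B).
  by rewrite ifT ?mulr1// inE; rewrite inE in uB.
by rewrite ifF ?mulr0//; apply/negbTE; move: uB; rewrite !notin_setE.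
Qed.

Import HBNNSimple.

(** The change of variables holds for indicators by [weighted_lawE], for simple functions by
    linearity, and for [f] by monotone convergence. *)
Lemma integral_weighted_law (f : T -> R) :
  measurable_fun setT f -> (forall x, 0 <= f x) ->
  (\int[mu]_u (G u * f (Z u))%:E = \int[weighted_law mZ mG G0]_x (f x)%:E)%E.
Proof.
move=> mf f0.
have mf' : measurable_fun setT (EFin \o f) by exact/measurable_EFinP.
pose h := nnsfun_approx measurableT mf'.
have hf x : ((h n x)%:E @[n --> \oo] --> (f x)%:E)%E.
  by apply: cvg_nnsfun_approx => //= y _; rewrite lee_fin.
have nd_h x : {homo (fun n => h n x) : a b / (a <= b)%N >-> a <= b}.
  by move=> a b ab; exact/lefP/nd_nnsfun_approx.
transitivity (limn (fun n => \int[mu]_u (G u * h n (Z u))%:E))%E.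
  rewrite -monotone_convergence//.
  - apply: eq_integral => u _; apply/esym/cvg_lim => //.
    rewrite (_ : (fun n => _) = (fun n => (G u)%:E * (h n (Z u))%:E)%E)//.
    by rewrite EFinM; apply: cvgeZl => //; exact: hf.
  - move=> n; apply/measurable_EFinP; apply: measurable_funM => //.
    by apply: measurableT_comp => //; exact: measurable_funP.
  - by move=> n u _; rewrite lee_fin mulr_ge0.
  - by move=> u _ a b ab; rewrite lee_fin ler_wpM2l// nd_h.
transitivity (limn (fun n => \int[weighted_law mZ mG G0]_x (h n x)%:E))%E; last first.
  rewrite -monotone_convergence//.
  - by apply: eq_integral => x _; exact/cvg_lim.
  - by move=> n; exact/measurable_EFinP/measurable_funP.
  - by move=> n x _; rewrite lee_fin.
  - by move=> x _ a b ab; rewrite lee_fin nd_h.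
congr (limn _); apply/funext => n.
transitivity (\sum_(r \in range (h n))
  \int[mu]_u (r * (G u * \1_(h n @^-1` [set r]) (Z u)))%:E)%E.
  rewrite -ge0_integral_fsum//.
  - apply: eq_integral => u _; rewrite fsumEFin//; congr EFin.
    rewrite [in LHS]fimfunE [LHS]mulrC mulr_fsuml//.
    by apply: eq_fsbigr => r _; rewrite -mulrA [_ * G u]mulrC.
  - move=> r; apply/measurable_EFinP; apply: measurable_funM => //.
    apply: measurable_funM => //.
    by apply: (measurableT_comp _ mZ); exact: measurable_indic.
  - move=> r u _; rewrite mulrCA lee_fin mulr_ge0//.
    by have := nnfun_muleindic_ge0 (h n) r (Z u); rewrite lee_fin.
transitivity (\sum_(r \in range (h n)) \int[weighted_law mZ mG G0]_x
    (r * \1_(h n @^-1` [set r]) x)%:E)%E; last first.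
  rewrite -ge0_integral_fsum//.
  - by apply: eq_integral => x _; rewrite fsumEFin//; congr EFin; rewrite [in RHS]fimfunE.
  - by move=> r; apply/measurable_EFinP; exact: measurable_funM.
  - by move=> r x _; exact: nnfun_muleindic_ge0.
apply: eq_fsbigr => r; rewrite inE => -[x _ hr].
have r0 : 0 <= r by rewrite -hr.
rewrite integralZl_indic_nnsfun// integral_indic// setIT.
under eq_integral do rewrite EFinM.
rewrite ge0_integralZl_EFin//.
- by rewrite -weighted_lawE.
- by move=> u _; rewrite lee_fin mulr_ge0.
- apply/measurable_EFinP; apply: measurable_funM => //.
  by apply: (measurableT_comp _ mZ); exact: measurable_indic.
Qed.

End weighted_law.

Section independence.
Context {disp disp' : measure_display} {Omega : measurableType disp}
  {T : measurableType disp'} {R : realType} (P : probability Omega R).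
Context {I : finType} (Z : I -> Omega -> T).

(** Factors are reduced to indicators one index at a time: the list [r] of the proof contains the
    indices whose factor is still arbitrary, and for empty [r] the claim is the definition of
    independence. *)
Lemma independent_prod (f : I -> T -> R) (e : I -> R) :
  mutually_independent P Z -> (forall i, measurable_fun setT (Z i)) ->
  (forall i, measurable_fun setT (f i)) -> (forall i x, 0 <= f i x) ->
  (forall i, (\int[P]_w (f i (Z i w))%:E = (e i)%:E)%E) ->
  (\int[P]_w (\prod_i f i (Z i w))%:E = (\prod_i e i)%:E)%E.
Proof.
move=> indZ mZ.
suff H (r : seq I) (f' : I -> T -> R) (e' : I -> R) :
    (forall i, measurable_fun setT (f' i)) -> (forall i x, 0 <= f' i x) ->
    (forall i, (\int[P]_w (f' i (Z i w))%:E = (e' i)%:E)%E) ->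
    (forall i, i \notin r -> exists2 B, measurable B & f' i = \1_B) ->
    (\int[P]_w (\prod_i f' i (Z i w))%:E = (\prod_i e' i)%:E)%E.
  move=> mf f0 fe; apply: (H (enum I)) => // i.
  by rewrite mem_enum.
have mpre i B : measurable B -> measurable (Z i @^-1` B).
  by move=> mB; rewrite -[X in measurable X]setTI; exact: mZ.
have int1 i B : measurable B ->
    (\int[P]_w (\1_B (Z i w))%:E = P (Z i @^-1` B))%E.
  move=> mB; rewrite -[in RHS](setIT (Z i @^-1` B)) -integral_indic//.
  exact: mpre.
elim: r f' e' => {f e} [|j r IH] f e mf f0 fe find.
  have /choice[B HB] : forall i, exists B, measurable B /\ f i = \1_B.
    by move=> i; have [//|B ? ?] := find i _; exists B.
  have mB i : measurable (B i) by have [] := HB i.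
  have eB i : (e i)%:E = P (Z i @^-1` B i).
    by rewrite -fe; have [_ ->] := HB i; rewrite int1.
  rewrite -prodEFin (eq_bigr _ (fun i _ => eB i)) -indZ//.
  rewrite -[in RHS](setIT [set w | _]) -integral_indic//; last first.
    exact: (@measurable_rect _ _ I).
  apply: eq_integral => w _; congr EFin; rewrite indicE.
  have [|] := boolP (w \in _).
    rewrite inE /= => h; rewrite big1// => i _.
    by have [_ ->] := HB i; rewrite indicE mem_set.
  rewrite notin_setE/= -existsNE => -[i hi]; rewrite (bigD1 i)//=.
  by have [_ ->] := HB i; rewrite indicE memNset// mul0r.
have e0 i : 0 <= e i.
  by rewrite -lee_fin -fe; apply: integral_ge0 => w _; rewrite lee_fin.
pose G w := \prod_(i | i != j) f i (Z i w).
pose K := \prod_(i | i != j) e i.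
have K0 : 0 <= K by apply: prodr_ge0.
have G0 w : 0 <= G w by apply: prodr_ge0.
have mG : measurable_fun setT G.
  have -> : G = fun w => \prod_i (if i != j then f i (Z i w) else 1).
    by apply/funext => w; exact: big_mkcond.
  apply: measurable_prod => i _; have [_|_] := boolP (i != j); last first.
    exact: measurable_cst.
  exact: (measurableT_comp (mf i) (mZ i)).
have mK : measurable_fun setT (fun _ : Omega => K) by exact: measurable_cst.
(* By the induction hypothesis with the indicator of [B] in place of [f j], weighting the law of
   [Z j] by the product [G] of the other factors or by the constant [K] gives the same measure,
   against which [f j] is then integrated. *)
have GK B : measurable B -> weighted_law P (mZ j) mG G0 B =
    weighted_law P (mZ j) mK (fun=> K0) B.
  move=> mB; rewrite !weighted_lawE//.
  pose f' i := if i == j then \1_B else f i.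
  pose e' i := if i == j then fine (P (Z j @^-1` B)) else e i.
  have jE w : G w * \1_B (Z j w) = \prod_i f' i (Z i w).
    rewrite [RHS](bigD1 j)//= mulrC {1}/f' eqxx; congr (_ * _).
    by apply: eq_bigr => i /negbTE ij; rewrite /f' ij.
  under eq_integral do rewrite jE.
  rewrite (IH f' e').
  - under eq_integral do rewrite EFinM.
    rewrite ge0_integralZl_EFin ?int1//.
      rewrite (bigD1 j)//= mulrC {2}/e' eqxx EFinM fineK ?fin_num_measure//; last exact: mpre.
      congr (_%:E * _)%E; apply: eq_bigr => i /negbTE ij.
      by rewrite /e' ij.
    apply/measurable_EFinP; apply: (measurableT_comp _ (mZ j)).
    exact: measurable_indic.
  - by move=> i; rewrite /f'; case: ifP.
  - by move=> i x; rewrite /f'; case: ifP.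
  - move=> i; rewrite /f' /e'; case: eqP => [->|//].
    by rewrite int1 ?fineK ?fin_num_measure//; exact: mpre.
  - move=> i ir; rewrite /f'; case: eqP => [_|/eqP ij]; first by exists B.
    by apply: find; rewrite inE negb_or ij.
transitivity (\int[P]_w (G w * f j (Z j w))%:E)%E.
  by apply: eq_integral => w _; rewrite (bigD1 j)//= mulrC.
rewrite (integral_weighted_law _ (mZ j) mG G0)//.
rewrite (eq_measure_integral (weighted_law P (mZ j) mK (fun=> K0))); last first.
  by move=> B mB _; exact: GK.
rewrite -integral_weighted_law//.
under eq_integral do rewrite EFinM.
rewrite ge0_integralZl_EFin//.
- by rewrite fe (bigD1 j)//= mulrC EFinM.
- by move=> w _; rewrite lee_fin.
- by apply/measurable_EFinP; exact: measurableT_comp.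
Qed.

End independence.

(** * Undersampled sets *)

Lemma measure_bigsetU_le {disp : measure_display} {T : measurableType disp}
    {R : realType} (mu : {measure set T -> \bar R}) {I : finType} (Q : pred I)
    (F : I -> set T) : (forall i, measurable (F i)) ->
  (mu (\big[setU/set0]_(i | Q i) F i) <= \sum_(i | Q i) mu (F i))%E.
Proof.
move=> mF; elim: (index_enum I) => [|i r IH]; first by rewrite !big_nil measure0.
rewrite !big_cons; case: (Q i) => //.
apply: le_trans (measureU2 _ _ _) _ => //; first exact: bigsetU_measurable.
exact: leeD2l.
Qed.

Section measurable_swap.
Context {disp : measure_display} {T : measurableType disp} {n : nat}.
Variable s : {ffun 'I_n -> bool}.

Lemma measurable_swap_tuple : measurable_fun setT (@swap_tuple n T s).
Proof. by apply: measurable_mktuple => k; exact: measurable_tnth. Qed.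

HB.instance Definition _ :=
  isMeasurableFun.Build _ _ _ _ (@swap_tuple n T s) measurable_swap_tuple.

End measurable_swap.

Section traces.
Context {R : realType} {d : nat}.
Variables (AA : set (set (d.-tuple R))) (v : nat).
Hypotheses (mAA : trace_measurable AA) (vcAA : vc_dim_eq AA v).

(** Universal measurability sandwiches each trace event between sets of equal measure. These
    measures add up to the expected number of inner sets [B1 I] containing [z], which is at most the
    number of traces on [z], bounded by Sauer's lemma. *)
Lemma trace_hulls (m : nat) (mu : probability (m.-tuple (d.-tuple R)) R) :
  exists B1 B2 : {set 'I_m} -> set (m.-tuple (d.-tuple R)),
  [/\ forall I, measurable (B1 I) /\ measurable (B2 I),
      forall I, B1 I `<=` [set z | has_trace AA z I] /\
                [set z | has_trace AA z I] `<=` B2 I,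
      forall I, mu (B1 I) = mu (B2 I) &
      (\sum_I mu (B2 I) <= (m.+1 ^ v)%:R%:E)%E].
Proof.
have /choice[B HB] I := mAA I mu.
have /choice[B' {}HB] := HB.
have mB I : measurable (B I) by have [] := HB I.
have mB' I : measurable (B' I) by have [] := HB I.
have BB' I : mu (B I) = mu (B' I).
  have [_ _ h1 h2 h3] := HB I.
  apply/eqP; rewrite eq_le le_measure ?inE//=; last exact: subset_trans h2.
  have -> : B' I = B I `|` (B' I `\` B I) by rewrite setDUK//; exact: subset_trans h2.
  apply: le_trans (measureU2 _ _ _) _ => //; first exact: measurableD.
  by rewrite [X in (_ + X)%E]h3 adde0.
exists B, B'; split => //.
- by move=> I; have [] := HB I.
- rewrite (eq_bigr (fun I => \int[mu]_z (\1_(B I) z)%:E)%E); last first.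
    by move=> I _; rewrite integral_indic// setIT -BB'.
  rewrite -ge0_integral_sum//; last first.
    by move=> I; exact/measurable_EFinP/measurable_indic.
  apply: (@le_trans _ _ (\int[mu]_z (m.+1 ^ v)%:R%:E)%E); last first.
    by rewrite integral_cst//= probability_setT mule1.
  apply: ge0_le_integral => //.
  + by move=> z _; apply: sume_ge0 => I _; rewrite lee_fin.
  + by apply: emeasurable_sum => I; exact/measurable_EFinP/measurable_indic.
  + move=> z _; rewrite sumEFin lee_fin; apply: le_trans (_ : (nb_traces AA z)%:R <= _).
      rewrite /nb_traces -sum1_card natr_sum [leRHS]big_mkcond/=.
      apply: ler_sum => I _; rewrite indicE.
      have [|_] := boolP (z \in B I); last by case: ifP.
      rewrite inE => zB; rewrite ifT//; apply/mem_set/asboolP.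
      by have [_ _ h _ _] := HB I; exact: h.
    by rewrite ler_nat; exact: nb_traces_le.
Qed.

(* mu [set z | has_trace AA z I] is invariant under the action of swaps on I,
   so the sum over unbalanced I can be averaged over all swaps. *)
Lemma sum_unbalanced_traces (n : nat)
    (mu : probability ((n + n).-tuple (d.-tuple R)) R) (Lam : R) :
  (forall s F, measurable F ->
    mu (swap_tuple s @^-1` F) = mu F) ->
  exists W, [/\ measurable W,
    forall z I, has_trace AA z I -> unbalanced Lam I -> W z &
    (mu W <= ((n + n).+1 ^ v)%:R%:E * (expR (- Lam))%:E)%E].
Proof.
move=> mu_swap.
have [B1 [B2 [mB hB B12 sB]]] := trace_hulls mu.
have mB1 I : measurable (B1 I) by have [] := mB I.
have mB2 I : measurable (B2 I) by have [] := mB I.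
pose q I := fine (mu (B2 I)).
have qE I : mu (B2 I) = (q I)%:E by rewrite fineK// fin_num_measure.
(* Invariance is transported from an inner hull to an outer one, which gives an inequality only;
   swapping a second time gives the reverse one. *)
have q_le s I : q I <= q (swap_set s I).
  rewrite -lee_fin -!qE -B12 -(mu_swap s)//; apply: le_measure; rewrite ?inE//.
    by rewrite -[X in measurable X]setTI; exact: measurable_swap_tuple.
  move=> z /= h; have [_] := hB (swap_set s I); apply.
  by apply: has_trace_swap; have [+ _] := hB I; exact.
have q_swap s I : q (swap_set s I) = q I.
  by apply/eqP; rewrite eq_le q_le -{2}(swap_setK s I) q_le.
have q0 I : 0 <= q I by rewrite -lee_fin -qE.
have sq : \sum_I q I <= ((n + n).+1 ^ v)%:R.
  by rewrite -lee_fin -sumEFin; apply: le_trans sB; apply: lee_sum => I _; rewrite qE.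
have bad : \sum_(I | unbalanced Lam I) q I <= ((n + n).+1 ^ v)%:R * expR (- Lam).
  have n2 : 0 < 2 ^+ n :> R by rewrite exprn_gt0.
  rewrite -(ler_pM2l n2) mulrCA.
  apply: le_trans (_ : \sum_I q I * (2 ^+ n * expR (- Lam)) <= _); last first.
    by rewrite -mulr_suml ler_wpM2r// mulr_ge0 ?expR_ge0// ltW.
  rewrite [leLHS](_ : _ = \sum_J q J *
      \sum_(s : {ffun 'I_n -> bool}) (unbalanced Lam (swap_set s J))%:R).
    by apply: ler_sum => J _; rewrite ler_wpM2l// sum_unbalanced.
  under [RHS]eq_bigr do rewrite mulr_sumr.
  set S := \sum_(I | unbalanced Lam I) q I.
  rewrite exchange_big/= (eq_bigr (fun _ => S)).
    by rewrite [RHS]sumr_const card_ffun card_bool card_ord -[RHS]mulr_natl natrX.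
  move=> s _; rewrite /S [RHS]big_mkcond (reindex_inj (inv_inj (swap_setK s)))/=.
  by apply: eq_bigr => J _; rewrite q_swap swap_setK; case: ifP; rewrite ?mulr1 ?mulr0.
exists (\big[setU/set0]_(I | unbalanced Lam I) B2 I); split.
- exact: bigsetU_measurable.
- move=> z I zI ubI; rewrite (bigD1 I)//=; left.
  by have [_] := hB I; exact.
- apply: le_trans (measure_bigsetU_le _ _ mB2) _.
  rewrite (eq_bigr (fun I => (q I)%:E)) => [|I _]; last exact: qE.
  by rewrite sumEFin -EFinM lee_fin.
Qed.

End traces.

(** * Symmetrization with a ghost sample *)

Section ghost_sample.
Context {disp : measure_display} {Omega : measurableType disp} {R : realType}
  (P : probability Omega R) {d n : nat}.
Context (Xs : 'I_n -> Omega -> d.-tuple R) (rho : probability (d.-tuple R) R).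
Hypothesis mXs : forall i, measurable_fun setT (Xs i).
Hypothesis indXs : mutually_independent P Xs.
Hypothesis lawXs : forall i B, measurable B -> P (Xs i @^-1` B) = rho B.

Let mpre i B : measurable B -> measurable (Xs i @^-1` B).
Proof. by move=> mB; rewrite -[X in measurable X]setTI; exact: mXs. Qed.

Let e1_le : expR (- 1) <= 1 / 2 :> R.
Proof.
have -> : 1 / 2 = 2^-1 :> R by rewrite mul1r.
by rewrite expRN lef_pV2 ?posrE ?expR_gt0//; have := expR_ge1Dx (1 : R); lra.
Qed.

(* Chernoff's bound, from E exp (- 1_B (X_i)) <= exp (- rho B / 2). *)
Lemma sample_lower_tail (B : set (d.-tuple R)) (p : R) :
  measurable B -> rho B = p%:E -> 6 <= n%:R * p ->
  (P [set w | \sum_(i < n) \1_B (Xs i w) < n%:R * p / 3]%R <= (1 / 2)%:E)%E.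
Proof.
move=> mB rhoB np6.
pose f (x : d.-tuple R) := expR (- \1_B x) : R.
pose e := 1 - p + expR (- 1) * p.
have mf : measurable_fun setT f.
  apply: measurableT_comp; first exact: measurable_expR.
  by apply: measurableT_comp => //; exact: measurable_indic.
have fE x : f x = \1_(~` B) x + expR (- 1) * \1_B x.
  rewrite /f !indicE in_setC; case: (x \in B) => /=; first by rewrite add0r mulr1.
  by rewrite oppr0 expR0 mulr0 addr0.
have int1 i C : measurable C -> (\int[P]_w (\1_C (Xs i w))%:E = rho C)%E.
  move=> mC; rewrite -(lawXs i)// -[in RHS](setIT (Xs i @^-1` C)) -integral_indic//.
  exact: mpre.
have m1 i C : measurable C -> measurable_fun setT (fun w => (\1_C (Xs i w))%:E : \bar R).
  move=> mC; apply/measurable_EFinP; apply: (measurableT_comp _ (mXs i)).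
  exact: measurable_indic.
have fe i : (\int[P]_w (f (Xs i w))%:E = e%:E)%E.
  under eq_integral do rewrite fE EFinD EFinM.
  rewrite ge0_integralD//; last 2 first.
  - by apply: m1; exact: measurableC.
  - by apply: measurable_funeM; exact: m1.
  rewrite ge0_integralZl_EFin ?expR_ge0//; last exact: m1.
  rewrite !int1//; last exact: measurableC.
  by rewrite rhoB probability_setC// rhoB /e EFinD EFinB.
have := independent_prod indXs mXs (fun=> mf) (fun=> fun=> expR_ge0 _) fe.
rewrite prodr_const card_ord => prodE.
pose S w : R := \sum_(i < n) \1_B (Xs i w).
have mS : measurable_fun setT S.
  by apply: measurable_sum => i; exact/measurable_EFinP/m1.
set G := [set w | _].
have mG : measurable G.
  rewrite (_ : G = S @^-1` `]-oo, (n%:R * p / 3)[%classic).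
    by rewrite -[X in measurable X]setTI; exact: mS.
  by apply/seteqP; split => w; rewrite /G/= in_itv.
have : ((expR (- (n%:R * p / 3)))%:E * P G <= (e ^+ n)%:E)%E.
  rewrite -prodE -[P G]/(_ G) -(setIT G) -integral_indic//.
  rewrite -ge0_integralZl_EFin ?expR_ge0//; last first.
    exact/measurable_EFinP/measurable_indic.
  apply: ge0_le_integral => //.
  - by apply/measurable_EFinP; apply: measurable_funM.
  - apply/measurable_EFinP; apply: measurable_prod => i _.
    exact: (measurableT_comp mf (mXs i)).
  - move=> w _; rewrite -EFinM lee_fin -expR_sum sumrN indicE.
    have [|_] := boolP (w \in G); last by rewrite mulr0 expR_ge0.
    by rewrite inE /G /= mulr1 ler_expR lerN2 => /ltW.
have p0 : 0 <= p by rewrite -lee_fin -rhoB.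
have eN : e ^+ n <= expR (- (n%:R * p / 2)).
  have -> : - (n%:R * p / 2) = (- (p / 2)) * n%:R by lra.
  rewrite expRM_natr lerXn2r ?nnegrE ?expR_ge0//; first 1 last.
    apply: le_trans (expR_ge1Dx _); rewrite /e.
    have := ler_wpM2r p0 e1_le; lra.
  have p1 : p <= 1 by rewrite -lee_fin -rhoB probability_le1.
  by rewrite /e addr_ge0 ?subr_ge0// mulr_ge0 ?expR_ge0.
have : P G \is a fin_num by rewrite fin_num_measure.
case: (P G) => // q _; rewrite -EFinM !lee_fin => /le_trans/(_ eN).
rewrite mulrC -ler_pdivlMr ?expR_gt0// -expRN -expRD => /le_trans; apply.
(* The exponent is [- n p / 2 + n p / 3 = - n p / 6], at most [- 1] since [n p >= 6]. *)
apply: le_trans e1_le; rewrite ler_expR; lra.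
Qed.

(** The ghost sample lives on a second copy of the probability space, which makes it independent of
    the first half under [P \x P]. *)
Definition paired (w : Omega * Omega) : (n + n).-tuple (d.-tuple R) :=
  [tuple match fintype.split k with inl i => Xs i w.1 | inr i => Xs i w.2 end
  | k < n + n].

Lemma measurable_paired : measurable_fun setT paired.
Proof.
apply: measurable_mktuple => k; case: (fintype.split k) => i.
  exact: measurableT_comp.
exact: measurableT_comp.
Qed.

HB.instance Definition _ := isMeasurableFun.Build _ _ _ _ paired measurable_paired.

Let mu : probability _ R := distribution (P \x P)%E paired.

Let mu_rect (B : 'I_(n + n) -> set (d.-tuple R)) : (forall k, measurable (B k)) ->
  mu (rect (fun k z => tnth z k) B) = (\prod_k rho (B k))%E.
Proof.
move=> mB.
have half (h : 'I_n -> 'I_(n + n)) :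
    P (rect Xs (B \o h)) = (\prod_i rho (B (h i)))%E.
  rewrite indXs; last by move=> i; exact: mB.
  by apply: eq_bigr => i _; rewrite lawXs//; exact: mB.
have mhalf (h : 'I_n -> 'I_(n + n)) : measurable (rect Xs (B \o h)).
  by apply: measurable_rect => // i; exact: mB.
rewrite /mu /distribution /= /pushforward.
rewrite (_ : _ @^-1` _ = rect Xs (B \o @lshift n n) `*` rect Xs (B \o @rshift n n)).
  by rewrite product_measure1E//= !half big_split_ord.
apply/seteqP; split => -[w1 w2] /=.
  move=> h; split => i.
    by have := h (lshift n i); rewrite tnth_mktuple (unsplitK (inl i)).
  by have := h (rshift n i); rewrite tnth_mktuple (unsplitK (inr i)).
move=> [h1 h2] k; rewrite tnth_mktuple; case: (splitP k) => i ki.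
  have -> : k = lshift n i by exact: val_inj.
  exact: h1.
have -> : k = rshift n i by exact: val_inj.
exact: h2.
Qed.

(** Both measures give a rectangle the product of the [rho (B k)], up to the order of the factors,
    and rectangles determine the measure. *)
Let mu_swap s F : measurable F -> mu (swap_tuple s @^-1` F) = mu F.
Proof.
move: F; apply: (tuple_measure_unique (m1 := pushforward mu (swap_tuple s))).
  move=> B mB; rewrite [RHS]mu_rect//.
  transitivity (mu (rect (fun k z => tnth z k) (B \o swap s))); last first.
    rewrite mu_rect => [|k]; last exact: mB.
    by rewrite [RHS](reindex_inj (inv_inj (swapK s))).
  suff <- : swap_tuple s @^-1` rect (fun k z => tnth z k) B =
      rect (fun k z => tnth z k) (B \o swap s) by [].
  apply/seteqP; split => z /= h k.
    by have := h (swap s k); rewrite tnth_mktuple swapK.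
  by rewrite tnth_mktuple; have := h (swap s k); rewrite /= swapK.
by apply: (@le_lt_trans _ _ 1%E); [exact: (probability_le1 mu measurableT)|exact: ltry].
Qed.

(* N is the set of samples for which at least half of the ghost samples give an
   unbalanced trace; if B is undersampled by w, then any of the many ghost
   samples that hit B often enough does. The event that some B is undersampled
   need not be measurable. *)
Lemma undersampled_small (AA : set (set (d.-tuple R))) (v : nat) (Lam : R) :
  trace_measurable AA -> vc_dim_eq AA v -> 1 <= Lam ->
  exists N, [/\ measurable N,
    (P N <= (2 * (((n + n).+1 ^ v)%:R * expR (- Lam)))%:E)%E &
    forall w B p, ~ N w -> AA B -> measurable B -> rho B = p%:E ->
      36 * Lam <= n%:R * p -> n%:R * p < 9 * \sum_(i < n) \1_B (Xs i w)].
Proof.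
move=> mAA vcAA Lam1.
have [W [mW WB W_le]] := sum_unbalanced_traces mAA vcAA Lam mu_swap.
pose W' := paired @^-1` W.
have mW' : measurable W'.
  by rewrite -[X in measurable X]setTI; exact: measurable_paired.
pose phi w := P (xsection W' w).
have mphi : measurable_fun setT phi := measurable_fun_xsection P mW'.
pose N := [set w | (2^-1)%:E <= phi w]%E.
have mN : measurable N.
  rewrite (_ : N = setT `&` phi @^-1` [set` `[(2^-1)%:E, +oo[%O]).
    apply: mphi => //; exact: emeasurable_itv.
  by rewrite setTI; apply/seteqP; split => w; rewrite /N /= in_itv/= andbT.
exists N; split => //.
  (* Markov's inequality for [phi], whose integral is [mu W] by definition of the product
     measure. *)
  have : ((2^-1)%:E * P N <= mu W)%E.
    rewrite -[P N]/(_ N) -(setIT N) -integral_indic// -ge0_integralZl_EFin//; last first.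
      exact/measurable_EFinP/measurable_indic.
    apply: ge0_le_integral => //.
    - by apply/measurable_EFinP; apply: measurable_funM.
    - move=> w _; rewrite -EFinM indicE; have [|_] := boolP (w \in N).
        by rewrite inE /N/= mulr1.
      by rewrite mulr0.
  move=> /le_trans/(_ W_le).
  rewrite -EFinM -lee_pdivlMl ?invr_gt0// invrK.
  by rewrite -EFinM.
move=> w B p Nw AB mB rhoB np; apply: contrapT => /negP; rewrite -leNgt => Sle.
apply: Nw; rewrite /N /= /phi.
pose G := [set w | \sum_(i < n) \1_B (Xs i w) < n%:R * p / 3]%R.
have mG : measurable G.
  pose S w : R := \sum_(i < n) \1_B (Xs i w).
  have mS : measurable_fun setT S.
    apply: measurable_sum => i; apply: (measurableT_comp _ (mXs i)).
    exact: measurable_indic.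
  rewrite (_ : G = S @^-1` `]-oo, (n%:R * p / 3)[%classic).
    by rewrite -[X in measurable X]setTI; exact: mS.
  by apply/seteqP; split => u; rewrite /G/= in_itv.
have GC : (2^-1%:E <= P (~` G))%E.
  have : (P G <= (1 / 2)%:E)%E by apply: sample_lower_tail => //; lra.
  rewrite probability_setC//.
  have : P G \is a fin_num by rewrite fin_num_measure.
  by case: (P G) => // q _; rewrite -EFinB !lee_fin; lra.
apply: le_trans GC _; apply: le_measure; rewrite ?inE.
- exact: measurableC.
- exact: measurable_xsection.
move=> w2 /= /negP; rewrite -leNgt => Gw2.
suff : W' (w, w2) by move=> ?; rewrite /xsection /=; exact: mem_set.
pose I := finset (fun k => `[< B (tnth (paired (w, w2)) k) >]).
have Il i : (lshift n i \in I) = (Xs i w \in B).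
  rewrite inE tnth_mktuple (unsplitK (inl i)).
  by apply/asboolP/idP; rewrite inE.
have Ir i : (rshift n i \in I) = (Xs i w2 \in B).
  rewrite inE tnth_mktuple (unsplitK (inr i)).
  by apply/asboolP/idP; rewrite inE.
apply: (WB _ I).
  by exists B => // k; rewrite inE; split => /asboolP.
have nl : (\sum_(i < n) (lshift n i \in I))%:R = \sum_(i < n) \1_B (Xs i w) :> R.
  by rewrite natr_sum; apply: eq_bigr => i _; rewrite Il indicE.
have nr : (\sum_(i < n) (rshift n i \in I))%:R = \sum_(i < n) \1_B (Xs i w2) :> R.
  by rewrite natr_sum; apply: eq_bigr => i _; rewrite Ir indicE.
(* The sample hits [B] at most [n p / 9] times and the ghost sample at least [n p / 3] times, which
   is three times as many and at least [12 * Lam]. *)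
by apply/andP; split; rewrite -?(ler_nat R) ?natrM ?nl ?nr; lra.
Qed.

End ghost_sample.

(** * The noise *)

Section transfer.
Context {disp disp' : measure_display} {Omega : measurableType disp}
  {T : measurableType disp'} {R : realType} (P : probability Omega R).

Lemma independent_some {I : finType} (Z : option I -> Omega -> T) :
  mutually_independent P Z -> mutually_independent P (fun i => Z (Some i)).
Proof.
move=> indZ B mB.
have mB' o : measurable (oapp B setT o) by case: o => [i|]; [exact: mB|exact: measurableT].
transitivity (P [set w | forall o, oapp B setT o (Z o w)]).
  congr (P _); apply/seteqP; split => w h i; last exact: (h (Some i)).
  by case: i => [i|//]; exact: h.
rewrite indZ// (bigD1 None)//= preimage_setT probability_setT mul1e.
rewrite (reindex_omap Some id)/=; last by case.
by apply: eq_bigl => i; rewrite eqxx.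
Qed.

Lemma independent_comp {disp'' : measure_display} {T' : measurableType disp''}
    {I : finType} (Z : I -> Omega -> T) (f : T -> T') :
  measurable_fun setT f ->
  mutually_independent P Z -> mutually_independent P (fun i => f \o Z i).
Proof.
move=> mf indZ B mB; apply: (indZ (fun i => f @^-1` B i)) => i.
by rewrite -[X in measurable X]setTI; exact: mf.
Qed.

(** With the constant weight 1, [weighted_law] is the law of [Z k], which is the same for all
    [k]. *)
Lemma integral_identically_distributed {I : finType} (Z : I -> Omega -> T)
    (f : T -> R) i j :
  identically_distributed P Z -> (forall i, measurable_fun setT (Z i)) ->
  measurable_fun setT f -> (forall x, 0 <= f x) ->
  (\int[P]_w (f (Z i w))%:E = \int[P]_w (f (Z j w))%:E)%E.
Proof.
move=> idZ mZ mf f0.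
have h k := integral_weighted_law P (mZ k) (measurable_cst (1 : R)) (fun=> ler01) mf f0.
transitivity (\int[P]_w (1 * f (Z i w))%:E)%E; first by under [RHS]eq_integral do rewrite mul1r.
transitivity (\int[P]_w (1 * f (Z j w))%:E)%E; last by under eq_integral do rewrite mul1r.
rewrite !h; apply: eq_measure_integral => B mB _.
have mpre k : measurable (Z k @^-1` B).
  by rewrite -[X in measurable X]setTI; exact: (mZ k).
have cE k : (\int[P]_(w in Z k @^-1` B) (cst 1%E w) = P (Z k @^-1` B))%E.
  by rewrite integral_cst// mul1e.
by etransitivity; [exact: cE|rewrite [LHS](idZ i j)//; exact/esym/cE].
Qed.

End transfer.

Section conditional_expectation.
Context {disp disp' : measure_display} {Omega : measurableType disp}
  {T : measurableType disp'} {R : realType} (P : probability Omega R).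

(* Truncating h below 0 is harmless because the integrals of Z and of h (X) over
   X @^-1` [set x | h x < 0] vanish. *)
Lemma bounded_cond_exp (X : {RV P >-> T}) (Z : Omega -> R) (h : T -> R) (c : R) :
  0 <= c -> (forall w, 0 <= Z w) -> is_cond_exp X Z h ->
  {ae P, forall w, h (X w) <= c} ->
  exists h' : T -> R, [/\ measurable_fun setT h', forall x, 0 <= h' x <= c &
    forall B, measurable B ->
      (\int[P]_w (Z w * \1_B (X w))%:E = \int[P]_w (h' (X w) * \1_B (X w))%:E)%E].
Proof.
move=> c0 Z0 [iZ mh ih eh] hc.
have mpre B : measurable B -> measurable (X @^-1` B).
  by move=> mB; rewrite -[X in measurable X]setTI; exact: measurable_funP.
have mZ : measurable_fun setT (EFin \o Z) by case/integrableP : iZ.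
pose hp x := Num.max (h x) 0.
have mhp : measurable_fun setT hp by exact: measurable_maxr.
exists (fun x => Num.min (hp x) c); split.
- exact: measurable_minr.
- by move=> x; rewrite le_min c0 /hp le_max lexx orbT/= ge_min lexx orbT.
move=> B mB.
have restrE (f : Omega -> R) : (\int[P]_w (f w * \1_B (X w))%:E =
    \int[P]_(w in X @^-1` B) (f w)%:E)%E.
  rewrite [RHS]integral_mkcond; apply: eq_integral => w _.
  rewrite /patch /= indicE; have [uB|uB] := boolP (X w \in B).
    by rewrite ifT ?mulr1// inE; rewrite inE in uB.
  by rewrite ifF ?mulr0//; apply/negbTE; move: uB; rewrite !notin_setE.
rewrite !restrE.
have mC : measurable [set x | h x < 0].
  rewrite (_ : [set x | _] = h @^-1` `]-oo, 0[%classic).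
    by rewrite -[X in measurable X]setTI; exact: mh.
  by apply/seteqP; split => u /=; rewrite in_itv.
have mhpX : measurable_fun setT (EFin \o (hp \o X)).
  apply/measurable_EFinP; apply: measurableT_comp => //; exact: measurable_funP.
transitivity (\int[P]_(w in X @^-1` B) (hp (X w))%:E)%E; last first.
  apply: ae_eq_integral => //.
  - exact: mpre.
  - exact: measurable_funTS.
  - apply: measurable_funTS; apply/measurable_EFinP.
    apply: (@measurableT_comp _ _ _ _ _ _ (fun x => Num.min (hp x) c)).
      exact: measurable_minr.
    exact: measurable_funP.
  - apply: filterS hc => w hcw _; congr EFin; apply/esym/min_idPl.
    by rewrite /hp ge_max hcw c0.
pose B1 := B `&` [set x | h x < 0]; pose B2 := B `\` [set x | h x < 0].
have mB1 : measurable B1 by exact: measurableI.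
have mB2 : measurable B2 by exact: measurableD.
have B12 : X @^-1` B = X @^-1` B1 `|` X @^-1` B2.
  by rewrite -preimage_setU /B1 /B2 setUIDK.
have dB12 : [disjoint X @^-1` B1 & X @^-1` B2].
  by apply/disj_set2P/seteqP; split => // w [/= [_ ?] [_ ?]].
rewrite B12 !ge0_integral_setU//; try exact: mpre; try exact: measurable_funTS.
- congr (_ + _)%E.
    transitivity (0%E : \bar R).
      apply/eqP; rewrite eq_le; apply/andP; split.
        rewrite eh// -[leRHS](integral0 P (X @^-1` B1)); apply: le_integral => //.
        - exact: mpre.
        - by apply: integrableS ih => //; exact: mpre.
        - exact: integrable0.
        - by move=> w; rewrite inE => -[_ /= hw]; rewrite lee_fin ltW.
      by apply: integral_ge0 => w _; rewrite lee_fin.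
    apply/esym/integral0_eq => w [_ /= hw].
    by rewrite /hp; congr EFin; apply/max_idPr/ltW.
  rewrite eh//; apply: eq_integral => w; rewrite inE => -[_ /= /negP].
  by rewrite -leNgt => hw; rewrite /hp; congr EFin; apply/esym/max_idPl.
- by move=> w _; rewrite lee_fin /hp le_max lexx orbT.
- by move=> w _; rewrite lee_fin.
Qed.

End conditional_expectation.

Section joint_variable.
Context {disp disp' : measure_display} {U : measurableType disp}
  {T : measurableType disp'} {m : nat} (Z : 'I_m -> {mfun U >-> T}).

Definition joint u := [tuple Z i u | i < m].

Lemma measurable_joint : measurable_fun setT joint.
Proof. by apply: measurable_mktuple => i; exact: measurable_funP. Qed.

HB.instance Definition _ := isMeasurableFun.Build _ _ _ _ joint measurable_joint.

End joint_variable.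

Section noise.
Context {disp : measure_display} {Omega : measurableType disp} {R : realType}
  (P : probability Omega R) {d n : nat}.
Context (X : {RV P >-> d.-tuple R}) (Y : {RV P >-> R})
  (Xs : 'I_n -> {RV P >-> d.-tuple R}) (Ys : 'I_n -> {RV P >-> R})
  (g : d.-tuple R -> R) (sigma : R).
Let Z := generic_and_sample X Y (fun i => Xs i) (fun i => Ys i).
Hypotheses (indZ : mutually_independent P Z) (idZ : identically_distributed P Z).
Hypothesis (mg : measurable_fun setT g).
Hypothesis (subG : cond_sub_gaussian X (fun w => Y w - g (X w)) sigma).

Let noise (z : d.-tuple R * R) := z.2 - g z.1.

Let measurable_noise : measurable_fun setT noise.
Proof. by apply: measurable_funB => //; exact: measurableT_comp. Qed.

Let mZ o : measurable_fun setT (Z o).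
Proof.
by case: o => [i|]; apply/measurable_fun_pairP; split; exact: measurable_funP.
Qed.

Let sample := joint Xs.

Let measurable_sample : measurable_fun setT sample.
Proof. exact: measurable_joint. Qed.

(** The value 1 outside [I] turns the exponential of the noise sum over [I] into a product over all
    indices, the form to which [independent_prod] applies. *)
Let wt (s : R) (I : {set 'I_n}) i (z : d.-tuple R * R) :=
  if i \in I then expR (s * noise z) else 1.

Let measurable_wt s I i : measurable_fun setT (wt s I i).
Proof.
rewrite /wt; case: (i \in I); last exact: measurable_cst.
apply: measurableT_comp; first exact: measurable_expR.
exact: measurable_funM.
Qed.

Let wt_ge0 s I i z : 0 <= wt s I i z.
Proof. by rewrite /wt; case: ifP => _ //; exact: expR_ge0. Qed.

(* exp (s eps_i) can be replaced by its conditional expectation h' (X_i): the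
   two weighted laws of the sample agree on rectangles. *)
Lemma integral_noise_weight (s : R) (I : {set 'I_n}) F : measurable F ->
  (\int[P]_w ((\prod_i wt s I i (Z (Some i) w)) * \1_F (sample w))%:E <=
   (expR (s ^+ 2 * sigma ^+ 2 / 2) ^+ #|I|)%:E * P (sample @^-1` F))%E.
Proof.
move=> mF.
set c := expR _.
have [_ /(_ s)[h hE hc]] := subG.
have [h' [mh' h'c h'E]] := bounded_cond_exp (expR_ge0 _) (fun=> expR_ge0 _) hE hc.
pose H i (z : d.-tuple R * R) := if i \in I then h' z.1 else 1.
have mH i : measurable_fun setT (H i).
  rewrite /H; case: (i \in I); last exact: measurable_cst.
  exact: measurableT_comp.
have H_ge0 i z : 0 <= H i z.
  by rewrite /H; case: ifP => // _; have /andP[] := h'c z.1.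
have mG (f : 'I_n -> d.-tuple R * R -> R) : (forall i, measurable_fun setT (f i)) ->
    measurable_fun setT (fun w => \prod_i f i (Z (Some i) w)).
  move=> mf; apply: measurable_prod => i _.
  exact: (measurableT_comp (mf i) (mZ (Some i))).
have G_ge0 (f : 'I_n -> d.-tuple R * R -> R) : (forall i z, 0 <= f i z) ->
    forall w, 0 <= \prod_i f i (Z (Some i) w).
  by move=> f0 w; apply: prodr_ge0.
pose m1 := weighted_law P measurable_sample (mG _ (measurable_wt s I)) (G_ge0 _ (wt_ge0 s I)).
pose m2 := weighted_law P measurable_sample (mG _ mH) (G_ge0 _ H_ge0).
have rectE (B : 'I_n -> set (d.-tuple R)) : (forall i, measurable (B i)) ->
  exists2 e : R, m1 (rect (fun i z => tnth z i) B) = e%:E &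
                 m2 (rect (fun i z => tnth z i) B) = e%:E.
  move=> mB.
  have mR : measurable (rect (fun (i : 'I_n) (z : n.-tuple (d.-tuple R)) => tnth z i) B).
    by apply: measurable_rect => // i; exact: measurable_tnth.
  have indE w : \1_(rect (fun (i : 'I_n) (z : n.-tuple (d.-tuple R)) => tnth z i) B) (sample w)
      = \prod_i \1_(B i) (Z (Some i) w).1 :> R.
    rewrite indicE; have [|] := boolP (_ \in _).
      rewrite inE /rect /= => hB; rewrite big1// => i _.
      by rewrite indicE mem_set//; have := hB i; rewrite tnth_mktuple.
    rewrite notin_setE /rect /= -existsNE => -[i]; rewrite tnth_mktuple => hi.
    by rewrite (bigD1 i)//= indicE memNset// mul0r.
  have m1B i : measurable_fun setT (fun z : d.-tuple R * R => \1_(B i) z.1 : R).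
    by apply: measurableT_comp => //; exact: measurable_indic.
  pose f1 i z := wt s I i z * \1_(B i) z.1.
  pose f2 i z := H i z * \1_(B i) z.1.
  have mf1 i : measurable_fun setT (f1 i) by exact: measurable_funM.
  have mf2 i : measurable_fun setT (f2 i) by exact: measurable_funM.
  have f10 i z : 0 <= f1 i z by rewrite mulr_ge0.
  have f20 i z : 0 <= f2 i z by rewrite mulr_ge0.
  (* These integrals are finite because [f2 i] is at most [c + 1]: [h'] is bounded by [c], and the
     weights outside [I] are 1. *)
  pose e i := fine (\int[P]_w (f2 i (Z (Some i) w))%:E).
  have e2 i : (\int[P]_w (f2 i (Z (Some i) w))%:E = (e i)%:E)%E.
    rewrite /e fineK// ge0_fin_numE; last by apply: integral_ge0 => w _; rewrite lee_fin.
    apply: (@le_lt_trans _ _ (\int[P]_w (c + 1)%:E)%E); last first.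
      by rewrite integral_cst//= probability_setT mule1 ltry.
    apply: ge0_le_integral => //.
    - by move=> w _; rewrite lee_fin.
    - apply/measurable_EFinP; exact: (measurableT_comp (mf2 i) (mZ (Some i))).
    - move=> w _; rewrite lee_fin /f2 -[leRHS]mulr1 ler_pM//.
      rewrite /H; case: ifP => _; last by rewrite ler_wpDl// expR_ge0.
      by have /andP[_] := h'c (Z (Some i) w).1; move=> /le_trans; apply; rewrite ler_wpDr.
  (* [Some i] is exchanged for [None], as the conditional expectation is given for the generic
     pair. *)
  have e1 i : (\int[P]_w (f1 i (Z (Some i) w))%:E = (e i)%:E)%E.
    rewrite -e2 (integral_identically_distributed (Some i) None)//.
    rewrite [RHS](integral_identically_distributed (Some i) None)//.
    rewrite /f1 /f2 /wt /H; case: (i \in I) => //.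
    exact: h'E.
  have ind' := independent_some indZ.
  have mZ' i := mZ (Some i).
  exists (\prod_i e i).
    rewrite /m1 /= weighted_lawE// -(independent_prod ind' mZ' mf1 f10 e1).
    by apply: eq_integral => w _; rewrite indE -big_split.
  rewrite /m2 /= weighted_lawE// -(independent_prod ind' mZ' mf2 f20 e2).
  by apply: eq_integral => w _; rewrite indE -big_split.
have m12 : m1 F = m2 F.
  apply: tuple_measure_unique => //.
    by move=> B mB; have [e h1 h2] := rectE B mB; exact: etrans h1 (esym h2).
  have [e + _] := rectE (fun=> setT) (fun=> measurableT).
  rewrite (_ : rect _ _ = setT) => [me|]; last by apply/seteqP; split.
  by rewrite [X in (X < _)%E](_ : _ = e%:E) ?ltry.
rewrite [leLHS](_ : _ = m2 F); last first.
  rewrite -m12; apply/esym.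
  exact: (weighted_lawE P measurable_sample (mG _ (measurable_wt s I))).
rewrite [leLHS](weighted_lawE P measurable_sample (mG _ mH))//.
rewrite -[P _]/(_ (sample @^-1` F)) -[in leRHS](setIT (sample @^-1` F)).
have mpF : measurable (sample @^-1` F).
  by rewrite -[X in measurable X]setTI; exact: measurable_sample.
rewrite -integral_indic// -ge0_integralZl_EFin ?exprn_ge0 ?expR_ge0//; last first.
  exact/measurable_EFinP/measurable_indic.
have prodH w : \prod_i H i (Z (Some i) w) <= c ^+ #|I|.
  rewrite -prodr_const [leRHS]big_mkcond; apply: ler_prod => i _.
  rewrite H_ge0/= /H; case: (i \in I) => //.
  by have /andP[_] := h'c (Z (Some i) w).1.
apply: ge0_le_integral => //.
- by move=> w _; rewrite lee_fin mulr_ge0// G_ge0.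
- apply/measurable_EFinP; apply: measurable_funM; first exact: (mG _ mH).
  by apply: (measurableT_comp _ measurable_sample); exact: measurable_indic.
- by apply/measurable_EFinP; apply: measurable_funM.
- move=> w _; rewrite -EFinM lee_fin !indicE.
  by rewrite ler_wpM2r.
Qed.

Let noise_sum (I : {set 'I_n}) w := \sum_(i in I) (Ys i w - g (Xs i w)).

Let measurable_noise_sum I : measurable_fun setT (noise_sum I).
Proof.
have -> : noise_sum I = fun w => \sum_i (if i \in I then noise (Z (Some i) w) else 0).
  by apply/funext => w; rewrite /noise_sum big_mkcond.
apply: measurable_sum => i; case: (i \in I); last exact: measurable_cst.
exact: (measurableT_comp measurable_noise (mZ (Some i))).
Qed.

Let deviation s I a := [set w | a <= s * noise_sum I w].

Let measurable_deviation s I a : measurable (deviation s I a).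
Proof.
rewrite (_ : deviation s I a = (fun w => s * noise_sum I w) @^-1` `[a, +oo[%classic).
  rewrite -[X in measurable X]setTI.
  have : measurable_fun setT (fun w => s * noise_sum I w) by exact: measurable_funM.
  by apply => //; exact: measurable_itv.
by apply/seteqP; split => w; rewrite /deviation /= in_itv/= andbT.
Qed.

Lemma noise_chernoff s I a F : measurable F ->
  (P (deviation s I a `&` sample @^-1` F) <=
   (expR (#|I|%:R * (s ^+ 2 * sigma ^+ 2 / 2) - a))%:E * P (sample @^-1` F))%E.
Proof.
move=> mF.
have mpF : measurable (sample @^-1` F).
  by rewrite -[X in measurable X]setTI; exact: measurable_sample.
set D := _ `&` _.
have mD : measurable D by exact: measurableI.
have : ((expR a)%:E * P D <=
    (expR (s ^+ 2 * sigma ^+ 2 / 2) ^+ #|I|)%:E * P (sample @^-1` F))%E.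
  apply: le_trans (integral_noise_weight s I mF).
  rewrite -[P D]/(_ D) -[in leLHS](setIT D) -integral_indic//.
  rewrite -ge0_integralZl_EFin ?expR_ge0//; last first.
    exact/measurable_EFinP/measurable_indic.
  apply: ge0_le_integral => //.
  - by apply/measurable_EFinP; apply: measurable_funM.
  - apply/measurable_EFinP; apply: measurable_funM; last first.
      by apply: (measurableT_comp _ measurable_sample); exact: measurable_indic.
    apply: measurable_prod => i _.
    exact: (measurableT_comp (measurable_wt s I i) (mZ (Some i))).
  - move=> w _; rewrite -EFinM lee_fin !indicE.
    have [|_] := boolP (w \in D); last first.
      by rewrite mulr0 mulr_ge0// prodr_ge0.
    rewrite inE => -[Dw Fw].
    have -> : sample w \in F by exact: mem_set.
    rewrite !mulr1.
    rewrite -big_mkcond/= -expR_sum ler_expR -mulr_sumr.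
    exact: Dw.
have : P D \is a fin_num by rewrite fin_num_measure.
have : P (sample @^-1` F) \is a fin_num by rewrite fin_num_measure.
case: (P D) (P (sample @^-1` F)) => // u [] // q _ _.
rewrite -!EFinM !lee_fin -expRM_natl expRD expRN => h.
by rewrite mulrAC ler_pdivlMr ?expR_gt0// mulrC.
Qed.

Lemma noise_uniform (AA : set (set (d.-tuple R))) (v : nat) (Lam : R) :
  0 < sigma -> trace_measurable AA -> vc_dim_eq AA v -> 0 < Lam ->
  exists N, [/\ measurable N,
    (P N <= (2 * ((n.+1 ^ v)%:R * expR (- Lam)))%:E)%E &
    forall w B, ~ N w -> AA B ->
      (\sum_(i < n) (Ys i w - g (Xs i w)) * \1_B (Xs i w)) ^+ 2 <=
      2 * sigma ^+ 2 * Lam * \sum_(i < n) \1_B (Xs i w)].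
Proof.
move=> sg0 mAA vcAA Lam0.
have [B1 [B2 [mB hB _ sB]]] := trace_hulls mAA vcAA (distribution P (joint Xs)).
(* For nonempty [I] this makes the variance term [#|I| t^2 sigma^2 / 2] equal to [Lam], so the
   deviation level [2 * Lam] leaves the exponent [- Lam]. For empty [I] the term is 0 and the same
   bound holds. *)
pose t (I : {set 'I_n}) := Num.sqrt (2 * Lam / (sigma ^+ 2 * #|I|%:R)).
have t_le (I : {set 'I_n}) : #|I|%:R * (t I ^+ 2 * sigma ^+ 2 / 2) <= Lam.
  rewrite /t sqr_sqrtr; last first.
    by rewrite divr_ge0// mulr_ge0// ?sqr_ge0// ltW.
  have [->|I0] := eqVneq #|I| 0%N; first by rewrite mul0r ltW.
  rewrite le_eqVlt; apply/orP; left; apply/eqP; field.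
  by rewrite pnatr_eq0 I0/= gt_eqF.
have t_sum (I : {set 'I_n}) (sg : R) : sg ^+ 2 = 1 ->
    (P (deviation (sg * t I)%R I (2 * Lam)%R `&` sample @^-1` B2 I) <=
     (expR (- Lam))%:E * P (sample @^-1` B2 I))%E.
  move=> sg1; apply: le_trans (noise_chernoff _ _ _ _) _; first by have [] := mB I.
  apply: lee_wpmul2r => //; rewrite lee_fin ler_expR exprMn sg1 mul1r.
  by have := t_le I; lra.
pose dev (I : {set 'I_n}) (sg : R) := deviation (sg * t I) I (2 * Lam) `&` sample @^-1` B2 I.
have mdev I sg : measurable (dev I sg).
  apply: measurableI; first exact: measurable_deviation.
  by rewrite -[X in measurable X]setTI; apply: measurable_sample => //; have [] := mB I.
pose bad I := dev I 1 `|` dev I (- 1).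
have mbad I : measurable (bad I) by exact: measurableU.
exists (\big[setU/set0]_I bad I); split.
- exact: bigsetU_measurable.
- apply: le_trans (measure_bigsetU_le _ _ mbad) _.
  apply: le_trans (_ : \sum_I ((2 * expR (- Lam))%:E * P (sample @^-1` B2 I)) <= _)%E.
    apply: lee_sum => I _; apply: le_trans (measureU2 _ (mdev _ _) (mdev _ _)) _.
    have := t_sum I 1 (expr1n _ _); have := t_sum I (- 1) (etrans (sqrrN 1) (expr1n _ _)).
    rewrite -/(dev I 1) -/(dev I (- 1)) => h1 h2.
    apply: le_trans (leeD h2 h1) _.
    by rewrite mulr_natl mulr2n EFinD ge0_muleDl ?lee_fin ?expR_ge0.
  rewrite -ge0_sume_distrr//.
  apply: le_trans (lee_wpmul2l _ sB) _; first by rewrite lee_fin mulr_ge0 ?expR_ge0.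
  by rewrite -EFinM lee_fin; lra.
move=> w B Nw AB.
pose I := finset (fun i => Xs i w \in B).
have SI : \sum_(i < n) (Ys i w - g (Xs i w)) * \1_B (Xs i w) = noise_sum I w.
  rewrite /noise_sum [RHS]big_mkcond/=; apply: eq_bigr => i _.
  by rewrite inE indicE; case: (_ \in _); rewrite ?mulr1 ?mulr0.
have NI : \sum_(i < n) \1_B (Xs i w) = #|I|%:R :> R.
  rewrite -sum1_card natr_sum [RHS]big_mkcond/=; apply: eq_bigr => i _.
  by rewrite inE indicE; case: (_ \in _).
rewrite SI NI.
have trI : has_trace AA (sample w) I.
  exists B => // i; rewrite inE tnth_mktuple; split => [/mem_set//|].
  by rewrite inE.
have B2I : B2 I (sample w) by have [_] := hB I; exact.
have small sg : (sg = 1) \/ (sg = - 1) -> sg * (t I * noise_sum I w) < 2 * Lam.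
  move=> sgE; rewrite ltNge; apply/negP => h; apply: Nw.
  rewrite (bigD1 I)//=; left; rewrite /bad /dev.
  by case: sgE h => -> h; [left|right]; split => //; rewrite /deviation /= -mulrA.
have := small 1 (or_introl erefl); have := small (- 1) (or_intror erefl).
rewrite mulN1r mul1r => h1 h2.
(* For empty [I] one cannot divide by [t I], which is 0, but the noise sum vanishes. *)
have [I0|I0] := eqVneq #|I| 0%N.
  rewrite I0 mulr0 /noise_sum big_pred0 ?expr0n//.
  by move=> i; rewrite (cards0_eq I0) finset.in_set0.
have I0' : 0 < #|I|%:R :> R by rewrite ltr0n lt0n.
have sq : (t I * noise_sum I w) ^+ 2 <= (2 * Lam) ^+ 2 by nra.
move: sq; rewrite exprMn /t sqr_sqrtr; last first.
  by rewrite divr_ge0// mulr_ge0// ?sqr_ge0// ltW.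
rewrite -ler_pdivlMl; last by rewrite divr_gt0 ?mulr_gt0 ?exprn_gt0.
move=> /le_trans; apply.
rewrite le_eqVlt; apply/orP; left; apply/eqP; field.
by rewrite !gt_eqF.
Qed.

End noise.

(** * The error bound *)

Section lipschitz.
Context {R : realType} {d : nat}.
Implicit Types (V : set (d.-tuple R)) (g : d.-tuple R -> R).

Lemma edist_ge0 (x y : d.-tuple R) : 0 <= Defs.edist x y.
Proof. exact: sqrtr_ge0. Qed.

(** The infimum is attained: at positive distance the difference quotient is a lower bound of all
    admissible constants, and at distance zero [L] already forces equal values. *)
Lemma lip_constP V g L : 0 <= L -> euclidean_lipschitz V g L ->
  0 <= lip_const g V /\ euclidean_lipschitz V g (lip_const g V).
Proof.
move=> L0 gL; set E := [set c | 0 <= c /\ euclidean_lipschitz V g c].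
have E0 : E !=set0 by exists L.
split; first by apply: lb_le_inf => // c [].
move=> x y Vx Vy; have [e0|] := eqVneq (Defs.edist x y) 0.
  by have := gL _ _ Vx Vy; rewrite e0 !mulr0.
rewrite neq_lt ltNge edist_ge0/= => e0.
rewrite -ler_pdivrMr//; apply: lb_le_inf => // c [_ gc].
by rewrite ler_pdivrMr//; exact: gc.
Qed.

(** Since [diam] is an extended real, [d]-th powers are compared first and the root is taken among
    reals only. *)
Lemma edist_le_diam V (x y : d.-tuple R) (D : R) : (0 < d)%N -> V x -> V y ->
  ((diam V) ^+ d <= D%:E)%E -> Defs.edist x y <= D `^ (1 / d%:R).
Proof.
move=> d0 Vx Vy VD.
have exy : ((Defs.edist x y)%:E <= diam V)%E by apply: ereal_sup_ubound; exists x, y.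
have pow_le k : (((Defs.edist x y) ^+ k)%:E <= (diam V) ^+ k)%E.
  elim: k => [|k IH]; first by rewrite expr0 expe0.
  rewrite exprS EFinM expeS lee_pmul// lee_fin ?edist_ge0//.
  by rewrite exprn_ge0// edist_ge0.
have := le_trans (pow_le d) VD; rewrite lee_fin => eD.
have dN0 : d%:R != 0 :> R by rewrite pnatr_eq0 -lt0n.
rewrite (_ : Defs.edist x y = (Defs.edist x y ^+ d) `^ (1 / d%:R)); last first.
  by rewrite -powR_mulrn ?edist_ge0// -powRrM mul1r divff// powRr1 ?edist_ge0.
apply: ge0_ler_powR => //.
- by rewrite nnegrE exprn_ge0// edist_ge0.
- by rewrite nnegrE (le_trans _ eD)// exprn_ge0// edist_ge0.
Qed.

End lipschitz.

Section pointwise_error.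
Context {R : realType} {disp : measure_display} {Omega : measurableType disp}
  (P : probability Omega R) {d n : nat}.
Context (Xs : 'I_n -> {RV P >-> d.-tuple R}) (Ys : 'I_n -> {RV P >-> R})
  (g : d.-tuple R -> R) (V : Omega -> d.-tuple R -> set (d.-tuple R)).

(** The error is the average of the noise plus the average of [g (Xs i w) - g x] over the sample
    points in [V w x]; the condition on squares bounds the first average by [b]. *)
Lemma local_estimator_error w x (b D : R) :
  let N := \sum_(i < n) \1_(V w x) (Xs i w) in
  0 < N ->
  (\sum_(i < n) (Ys i w - g (Xs i w)) * \1_(V w x) (Xs i w)) ^+ 2 <= (b * N) ^+ 2 ->
  0 <= b ->
  (forall y, V w x y -> `|g y - g x| <= D) ->
  `|local_estimator V Xs Ys w x - g x| <= b + D.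
Proof.
move=> N N0 Sb b0 gD; set S := \sum_(i < n) _ in Sb.
rewrite /local_estimator -/N.
have -> : (\sum_(i < n) Ys i w * \1_(V w x) (Xs i w)) / N - g x =
    (S + \sum_(i < n) (g (Xs i w) - g x) * \1_(V w x) (Xs i w)) / N.
  apply: (mulIf (lt0r_neq0 N0)); rewrite mulrBl !divfK ?lt0r_neq0//.
  rewrite /S /N mulr_sumr -sumrB -big_split/=; apply: eq_bigr => i _.
  by rewrite -mulrDl -mulrBl; congr (_ * _); ring.
rewrite normrM (@ger0_norm _ N^-1) ?invr_ge0 ?(ltW N0)//.
rewrite ler_pdivrMr// mulrDl; apply: le_trans (ler_normD _ _) _; apply: lerD.
  by rewrite -ler_sqr ?nnegrE ?mulr_ge0 ?(ltW N0)// real_normK ?num_real.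
apply: le_trans (ler_norm_sum _ _ _) _; rewrite mulr_sumr.
apply: ler_sum => i _; rewrite indicE; have [|_] := boolP (_ \in _).
  by rewrite inE => /gD; rewrite !mulr1.
by rewrite !mulr0 normr0.
Qed.

End pointwise_error.

Section constants.
Context {R : realType}.

(** The mass bounds give [n r <= 9 A N / l], which turns [lg = n q^2 r] into a multiple of
    [q^2 N / l]. The constants are [4 * 9 = 6^2] and [A <= A^2]. *)
Lemma noise_rate (A sigma l lg q r n p N S : R) :
  1 <= A -> 0 < sigma -> 0 < l -> 0 <= q -> 0 < N -> 0 < n ->
  lg = n * (q ^+ 2 * r) -> l * (A^-1 * r) <= p -> n * p <= 9 * N ->
  S ^+ 2 <= 4 * sigma ^+ 2 * lg * N ->
  S ^+ 2 <= (6 * A * Num.sqrt (sigma ^+ 2 / l) * q * N) ^+ 2.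
Proof.
move=> A1 s0 l0 q0 N0 n0 lgE lp np SN; apply: le_trans SN _.
have A0 : 0 < A by lra.
rewrite !exprMn sqr_sqrtr; last by rewrite divr_ge0// ?sqr_ge0// ltW.
have key : n * r <= 9 * A * N / l.
  rewrite ler_pdivlMr//.
  have : n * (l * (A^-1 * r)) <= 9 * N by apply: le_trans np; rewrite ler_wpM2l// ltW.
  have -> : n * (l * (A^-1 * r)) = (n * r * l) / A by field; lra.
  rewrite ler_pdivrMr//; lra.
have -> : 4 * sigma ^+ 2 * lg * N = (4 * sigma ^+ 2 * q ^+ 2 * N) * (n * r).
  by rewrite lgE; ring.
have c0 : 0 <= 4 * sigma ^+ 2 * q ^+ 2 * N by rewrite !mulr_ge0// ?sqr_ge0// ltW.
apply: le_trans (ler_wpM2l c0 key) _.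
have -> : 4 * sigma ^+ 2 * q ^+ 2 * N * (9 * A * N / l) =
   (36 * (sigma ^+ 2 / l) * q ^+ 2 * N ^+ 2) * A by field; lra.
have -> : 6 ^+ 2 * A ^+ 2 * (sigma ^+ 2 / l) * q ^+ 2 * N ^+ 2 =
   (36 * (sigma ^+ 2 / l) * q ^+ 2 * N ^+ 2) * (A * A) by field; lra.
rewrite ler_wpM2l//; last by rewrite ler_peMl// ltW.
by rewrite !mulr_ge0 ?sqr_ge0 ?invr_ge0// ltW.
Qed.

(** The exponents [2 / (d + 2)] and [d / (d + 2)] add up to 1: the squared rate times the volume
    scale of the cells is [lg / n]. *)
Lemma rate_powR (u : R) (d : nat) : 0 < u ->
  u = (u `^ (1 / d.+2%:R)) ^+ 2 * u `^ (d%:R / d.+2%:R).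
Proof.
move=> u0; rewrite -powR_mulrn ?powR_ge0// -powRrM -powRD; last by rewrite gt_eqF ?implybT.
rewrite -[LHS]powRr1 ?(ltW u0)//; congr (_ `^ _).
by rewrite mul1r mulrC -mulrDl -natrD divff// pnatr_eq0.
Qed.

End constants.

(** * The good event and the final bound *)

Theorem theorem12 (R : realType) (A : R) (hA : 1 <= A) :
  exists2 C : R, 0 < C &
  forall (d n v : nat) (delta gamma L sigma : R)
    (disp : measure_display) (Omega : measurableType disp)
    (P : probability Omega R)
    (S : set (d.-tuple R))
    (X : {RV P >-> d.-tuple R}) (Y : {RV P >-> R})
    (Xs : 'I_n -> {RV P >-> d.-tuple R}) (Ys : 'I_n -> {RV P >-> R})
    (g : d.-tuple R -> R)
    (l : d.-tuple R -> R)
    (V : Omega -> d.-tuple R -> set (d.-tuple R))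
    (AA : set (set (d.-tuple R))),
  let Z := generic_and_sample X Y (fun i => Xs i) (fun i => Ys i) in
  let lg := ln (n.+1%:R ^+ v / delta) in
  let r := (lg / n%:R) `^ (d%:R / d.+2%:R) in
  (0 < d)%N -> (0 < n)%N -> 0 < delta < 1 / 3 -> 0 < gamma ->
  measurable S -> {ae P, forall w, S (X w)} ->
  is_cond_exp X Y g ->
  local_map P S V ->
  trace_measurable AA ->
  (* (a) *)
  mutually_independent P Z -> identically_distributed P Z ->
  (* (b) *)
  0 < sigma -> cond_sub_gaussian X (fun w => Y w - g (X w)) sigma ->
  (* (c) *)
  0 <= L -> euclidean_lipschitz S g L ->
  (* (d) *)
  (forall x, S x -> 0 < l x) ->
  {ae P, forall w, forall x, S x ->
    ((l x)%:E * lebesgue (V w x) <= distribution P X (V w x))%E} ->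
  (* (e) *)
  vc_local_map P S V AA v -> large_map S V Xs X v delta ->
  (* (f) *)
  shape_regular P S V gamma ->
  (* (g) *)
  {ae P, forall w, forall x, S x ->
    ((A^-1 * r)%:E <= lebesgue (V w x) <= (A * r)%:E)%E} ->
  exists E : set Omega,
    [/\ measurable E, ((1 - 3 * delta)%:E <= P E)%E &
      forall w x, E w -> S x ->
        `|local_estimator V Xs Ys w x - g x| <=
        C * (Num.sqrt (sigma ^+ 2 / l x)
             + lip_const g (V w x) * gamma `^ (1 / d%:R))
          * (n%:R^-1 * lg) `^ (1 / d.+2%:R)].
Proof.
have A0 : 0 < A by lra.
(* [6 * A] is the constant of [noise_rate]; the bias is bounded with constant [A]. *)
exists (6 * A); first by rewrite mulr_gt0.
move=> d n v delta gamma L sigma disp Omega P S X Y Xs Ys g l V AA Z lg r.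
move=> d0 n0 /andP[del0 del3] gam0 mS _ [_ mg _ _] locV mAA indZ idZ sig0 subG.
move=> L0 gL l0 dens [vcAA inAA] large shape size.
have n0' : 0 < n%:R :> R by rewrite ltr0n.
have [v0 _ _] := vcAA.
(* With [Lam] and [Lam'] the products of trace counts and exponentials are [delta / 4] and
   [delta / 2], so the bad events [N1] and [N2] have probabilities at most [delta / 2] and
   [delta]. *)
pose Lam := ln (4 * (2 * n).+1%:R ^+ v / delta).
pose Lam' := ln (2 * n.+1%:R ^+ v / delta).
have pow_ge (m : nat) : 1 <= m.+1%:R ^+ v :> R.
  by rewrite exprn_ege1// ler1n.
have Dpos (c : R) m : 0 < c -> 0 < c * m.+1%:R ^+ v / delta.
  by move=> c0; rewrite divr_gt0// mulr_gt0// exprn_gt0// ltr0n.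
have Dge (c : R) m : 0 < c -> 3 * c <= c * m.+1%:R ^+ v / delta.
  move=> c0; rewrite ler_pdivlMr//; apply: (@le_trans _ _ c); first by nra.
  by rewrite ler_peMr// ltW.
(* As [delta < 1 / 3], the argument of the logarithm is at least 12, while [expR 1 <= 4] because
   [expR (1 / 2) <= 2]. *)
have Lam1 : 1 <= Lam.
  rewrite -[leLHS]expRK ler_ln ?posrE ?expR_gt0 ?Dpos//.
  apply: le_trans (Dge 4 (2 * n)%N _) => //.
  have e0 := expR_gt0 (1 / 2 : R).
  have e2 : expR (1 / 2) <= 2 :> R.
    have := expR_ge1Dx (- (1 / 2) : R).
    by rewrite expRN -(ler_pM2l e0) divff ?lt0r_neq0//; lra.
  have -> : expR 1 = expR (1 / 2) * expR (1 / 2) :> R by rewrite -expRD; congr expR; lra.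
  by nra.
have lg_pos : 0 < lg.
  rewrite /lg ln_gt0// ; have := Dge 1 n ltr01; rewrite mul1r; lra.
(* The summand [ln 2] of [Lam'] is at most [lg], since the argument of the logarithm in [lg] is at
   least 3. *)
have Lam'_le : Lam' <= 2 * lg.
  rewrite /Lam' -mulrA lnM ?posrE//; last by have := Dpos 1 n ltr01; rewrite mul1r.
  rewrite -/lg [leRHS]mulr_natl mulr2n lerD2r ler_ln ?posrE//.
    by have := Dge 1 n ltr01; rewrite mul1r; lra.
  by have := Dpos 1 n ltr01; rewrite mul1r.
have Lam'0 : 0 < Lam'.
  rewrite /Lam' ln_gt0//; have := Dge 2 n; lra.
pose u := lg / n%:R.
have u0 : 0 < u by rewrite divr_gt0.
pose q := u `^ (1 / d.+2%:R).
have r0 : 0 < r by rewrite powR_gt0.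
have indXY : mutually_independent P (fun i => Z (Some i)) := independent_some indZ.
have mZ o : measurable_fun setT (Z o).
  by case: o => [i|]; apply/measurable_fun_pairP; split; exact: measurable_funP.
have indX : mutually_independent P (fun i => Xs i : Omega -> d.-tuple R).
  exact: (independent_comp (measurable_fst) indXY).
have lawX i B : measurable B -> P (Xs i @^-1` B) = distribution P X B.
  move=> mB; have mB' : measurable (B `*` [set: R]) by exact: measurableX.
  have := idZ (Some i) None _ mB'.
  rewrite (_ : Z (Some i) @^-1` _ = Xs i @^-1` B); last first.
    by apply/seteqP; split => w //= [].
  rewrite (_ : Z None @^-1` _ = X @^-1` B)//.
  by apply/seteqP; split => w //= [].
have [N1 [mN1 PN1 HN1]] :=
  undersampled_small (fun i => measurable_funP (Xs i)) indX lawX mAA vcAA Lam1.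
have [N2 [mN2 PN2 HN2]] := noise_uniform indZ idZ mg subG sig0 mAA vcAA Lam'0.
(* Outside the null set [N3] all the almost sure conditions on [V] hold, for every [x] in [S] at
   once. *)
have [N3 [mN3 PN3 HN3]] := filterI locV (filterI dens (filterI inAA
  (filterI large (filterI shape size)))).
exists (~` (N1 `|` N2 `|` N3)); split.
- by apply: measurableC; apply: measurableU => //; exact: measurableU.
- have mN : measurable (N1 `|` N2 `|` N3) by apply: measurableU => //; exact: measurableU.
  have : (P (N1 `|` N2 `|` N3) <= (3 * delta)%:E)%E.
    apply: le_trans (measureU2 _ _ _) _ => //; first exact: measurableU.
    rewrite [X in (_ + X)%E]PN3 adde0.
    apply: le_trans (measureU2 _ _ _) _ => //.
    apply: le_trans (leeD PN1 PN2) _.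
    rewrite -EFinD lee_fin /Lam /Lam' !expRN !lnK ?posrE ?Dpos//.
    have P1 := Dpos 1 (n + n)%N ltr01; have P2 := Dpos 1 n ltr01.
    rewrite !natrX (_ : (2 * n)%N = (n + n)%N); last by rewrite mul2n addnn.
    have := pow_ge (n + n)%N; have := pow_ge n.
    set a := _ ^+ v; set b := _ ^+ v => a1 b1.
    have -> : 2 * (b * (4 * b / delta)^-1) + 2 * (a * (2 * a / delta)^-1) = 3 / 2 * delta.
      by field; rewrite !gt_eqF//; lra.
    lra.
  rewrite probability_setC//.
  have : P (N1 `|` N2 `|` N3) \is a fin_num by rewrite fin_num_measure.
  by case: (P _) => // t _; rewrite -EFinB !lee_fin; lra.
move=> w x Ew Sx.
have nN1 : ~ N1 w by move=> h; apply: Ew; left; left.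
have nN2 : ~ N2 w by move=> h; apply: Ew; left; right.
have nN3 : ~ N3 w by move=> h; apply: Ew; right.
have /contrapT[hloc [hdens [hAA [hlarge [hshape hsize]]]]] :=
  (fun h => nN3 (HN3 w h)).
have {hloc}[mV VS Vx] := hloc _ Sx.
move: {hdens hAA hlarge hshape hsize} (hdens _ Sx) (hAA _ Sx) (hlarge _ Sx)
  (hshape _ Sx) (hsize _ Sx).
set B := V w x in mV VS Vx * => dens_x AB large_x shape_x /andP[size1 size2].
have rhoE : distribution P X B = (fine (distribution P X B))%:E.
  by rewrite fineK// fin_num_measure.
set p := fine _ in rhoE.
pose N := \sum_(i < n) \1_B (Xs i w) : R.
(* If [n p <= N], largeness bounds [N] itself below by [36 * Lam]; otherwise it bounds [n p], and
   being outside [N1] prevents undersampling. *)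
have [N0 np] : 0 < N /\ n%:R * p <= 9 * N.
  move: large_x; rewrite -/Lam rhoE -EFin_max -EFinM lee_fin /emp_measure -/N.
  rewrite maxr_pMr ?(ltW n0')// le_max mulrA divff ?gt_eqF// mul1r.
  have [pN|Np] := leP (n%:R * p) N.
    by case/orP => h; split; lra.
  move=> h; have {}h : 36 * Lam <= n%:R * p by case/orP: h => h; lra.
  by have := HN1 w B p nN1 AB mV rhoE h; rewrite -/N => h'; split; lra.
have lebE : lebesgue B = (fine (lebesgue B))%:E.
  have leb0 : (0 <= lebesgue B)%E.
    by apply: le_trans size1; rewrite lee_fin mulr_ge0 ?invr_ge0// ltW.
  by rewrite fineK// ge0_fin_numE// (le_lt_trans size2)// ltry.
move: size1 size2 dens_x shape_x; rewrite lebE rhoE !lee_fin -!EFinM.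
set t := fine _ => size1 size2 dens_x shape_x.
have lp : l x * (A^-1 * r) <= p.
  by apply: le_trans dens_x; rewrite ler_wpM2l// ltW// l0.
have SN := HN2 w B nN2 AB; rewrite -/N in SN.
have gLV : euclidean_lipschitz B g L by move=> y z By Bz; apply: gL; apply: VS.
have [lip0 gV] := lip_constP L0 gLV.
have lgE : lg = n%:R * (q ^+ 2 * r).
  by rewrite /q /r -/u -rate_powR// /u mulrC divfK// gt_eqF.
have -> : (n%:R^-1 * lg) `^ (1 / d.+2%:R) = q by rewrite mulrC.
have q0 : 0 < q by rewrite powR_gt0.
rewrite mulrDr mulrDl.
apply: local_estimator_error => //.
- apply: (noise_rate (l := l x) (lg := lg) (r := r) (n := n%:R) (p := p)) => //.
  + exact: l0.
  + exact: ltW.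
  + apply: le_trans SN _; rewrite -/N ler_wpM2r ?(ltW N0)//.
    have -> : 4 * sigma ^+ 2 * lg = 2 * sigma ^+ 2 * (2 * lg) by ring.
    by rewrite ler_wpM2l// mulr_ge0// sqr_ge0.
- by rewrite !mulr_ge0 ?sqrtr_ge0// ltW.
move=> y By.
apply: le_trans (gV _ _ By Vx) _.
(* Shape regularity bounds the distance by the [d]-th root of [gamma * (A * r)]. The root of [r] is
   [q], and that of [A] is at most [A] since [A >= 1]. *)
have yx : Defs.edist y x <= gamma `^ (1 / d%:R) * (A * q).
  apply: le_trans (edist_le_diam d0 By Vx shape_x) _.
  have gt_le : gamma * t <= gamma * (A * r) by rewrite ler_wpM2l// ltW.
  apply: (@le_trans _ _ ((gamma * (A * r)) `^ (1 / d%:R))).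
    apply: ge0_ler_powR => //; rewrite nnegrE.
    - by rewrite mulr_ge0 ?(ltW gam0)// (le_trans _ size1)// mulr_ge0 ?invr_ge0// ltW.
    - by rewrite !mulr_ge0// ltW.
  rewrite powRM ?(ltW gam0)// ?mulr_ge0 ?(ltW A0) ?(ltW r0)//.
  rewrite powRM ?(ltW A0) ?(ltW r0)// ler_wpM2l ?powR_ge0//.
  have -> : r `^ (1 / d%:R) = q.
    rewrite /r -/u -powRrM /q; congr (_ `^ _).
    by rewrite mul1r mulrAC divff ?mul1r// pnatr_eq0 -lt0n.
  rewrite ler_wpM2r ?(ltW q0)// ler1_powR//.
  by rewrite mul1r invf_le1 ?ltr0n// ler1n.
apply: le_trans (ler_wpM2l lip0 yx) _.
have -> : lip_const g B * (gamma `^ (1 / d%:R) * (A * q)) =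
  A * (lip_const g B * gamma `^ (1 / d%:R) * q) by ring.
have -> : 6 * A * (lip_const g B * gamma `^ (1 / d%:R)) * q =
  6 * A * (lip_const g B * gamma `^ (1 / d%:R) * q) by ring.
rewrite ler_wpM2r ?mulr_ge0 ?powR_ge0 ?(ltW q0)//; lra.
Qed.
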